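(* Let $$a^*(\tau):=\frac{1}{5(1+2\tau\sqrt\Delta)\,\xi(\kappa,\Delta,\tau)},\qquad \xi(\kappa,\Delta,\tau):=\sqrt{1+\frac{1}{2\kappa}\min\Big\{\frac1{\sqrt\Delta},\tau\Big\}}.$$ For any step size $\gamma=\frac aL$ with $0<a\le\min\{a^*(\tau),\frac\kappa\tau\}$, the inconsistent read iterates $\hat x_t$ of HOGWILD converge in expectation to $b$-accuracy at a geometric rate of at least $\rho(a)=\frac{a}{\kappa}$, i.e. $$\mathbb{E}\|\hat x_t-x^*\|^2\le(1-\rho)^t\,\big(2\|x_0-x^*\|^2\big)+b,\qquad b=\Big(\frac{8\gamma(C_1+\tau C_2)}{\mu}+4\gamma^2C_1\tau\Big)\sigma^2,$$ where $\rho=\rho(a)$, $C_1:=1+\sqrt\Delta\,\tau$ and $C_2=C_2(\gamma):=\sqrt\Delta+\gamma\mu C_1$.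
   Context: Let $f(x)=\frac1n\sum_{i=1}^n f_i(x)$ on $\mathbb{R}^d$, where each $f_i$ is convex and differentiable with $L$-Lipschitz gradient $f_i'$, and $f$ is $\mu$-strongly convex ($\mu>0$). Let $\kappa:=L/\mu$, let $x^*$ be the minimizer of $f$, and let $\sigma^2:=\frac1n\sum_{i=1}^n\|f_i'(x^* )\|^2$. $\|\cdot\|$ is the Euclidean norm and $[x]_v$ denotes coordinate $v$ of $x$. For each $i$, $S_i\subseteq\{1,\dots,d\}$ is the support of $f_i'$, i.e. the set of coordinates where $f_i'$ can be nonzero. The sparsity constant is $\Delta:=\frac1n\max_{v}|\{i:v\in S_i\}|\in[\frac1n,1]$. HOGWILD (asynchronous parallel constant-step-size SGD, step size $\gamma$). Shared memory holds $x\in\mathbb{R}^d$, initialized at $x_0$. Several cores repeat in parallel, without locks: read all coordinates of $x$ (possibly inconsistently, i.e. coordinates are read at different times while other cores write), giving $\hat x$; sample $i$ uniformly in $\{1,\dots,n\}$; for each $v\in S_i$ atomically do $[x]_v\leftarrow[x]_v-\gamma[f_i'(\hat x)]_v$. Labeling (''after read''): iterations are labeled $t=0,1,2,\dots$ in the order in which their reads are completed; $\hat x_t$, $i_t$ are the read vector and sampled index of iteration $t$, and $g_t:=f_{i_t}'(\hat x_t)$. The index $i_t$ is uniform on $\{1,\dots,n\}$ and independent of everything in the past of the completed read $t$ (all $\hat x_u$, $u\le t$, and all $i_u$, $u<t$). Bounded overlap assumption with constant $\tau\ge0$ (integer): an iteration is being processed from the start of its read to the end of its writes, and iterations $r$ and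 $t$ are never processed concurrently when $r\ge t+\tau+1$; thus all coordinate writes of iteration $t$ are in memory before iteration $t+\tau+1$ starts. Hence, with virtual iterates $x_{t+1}:=x_t-\gamma g_t$ (starting from $x_0$), one has $\hat x_t-x_t=\gamma\sum_{u=(t-\tau)_+}^{t-1}G_u^tg_u$, where $G_u^t$ are diagonal matrices with entries in $\{0,1\}$. For $\tau=0$, read $\kappa/\tau=+\infty$. *)

(* Defs.v *)
From HB Require Import structures.
From mathcomp Require Import all_boot all_order all_algebra.
From mathcomp Require Import all_classical all_reals all_analysis.

Set Implicit Arguments.
Unset Strict Implicit.
Unset Printing Implicit Defensive.

Import Order.TTheory GRing.Theory Num.Theory.
Import numFieldNormedType.Exports.

Local Open Scope classical_set_scope.
Local Open Scope ring_scope.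

Section objective.
Context {R : realType} {d n : nat}.
Implicit Types (x y : 'rV[R]_d) (h : 'rV[R]_d -> R)
  (fs : 'I_n -> 'rV[R]_d -> R).

(* The library norm [`|x|] on row vectors is the sup norm: it is used only
   through the topology underlying [differentiable] and ['D_v]. *)
Definition enorm x : R := Num.sqrt (\sum_(v < d) x 0 v ^+ 2).

Definition grad h x : 'rV[R]_d := \row_(v < d) 'D_(delta_mx 0 v) h x.

Definition lipschitz_grad (L : R) h :=
  forall x y, enorm (grad h x - grad h y) <= L * enorm (x - y).

Definition strongly_convex (mu : R) h :=
  convex_function setT (fun x => h x - mu / 2 * enorm x ^+ 2).

Definition mean_obj fs x : R := n%:R^-1 * \sum_(i < n) fs i x.

Definition grad_variance fs x : R :=
  n%:R^-1 * \sum_(i < n) enorm (grad (fs i) x) ^+ 2.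

Definition grad_support h : {set 'I_d} :=
  [set v | `[< exists x, grad h x 0 v != 0 >]]%SET.

Definition sparsity fs : R :=
  (\max_(v < d) #|[set i | v \in grad_support (fs i)]%SET|)%:R / n%:R.

End objective.

(* An execution is the sequence of its atomic single-coordinate accesses to
   the shared memory; the nat argument is the label of the iteration which
   performs the access. *)
Variant access (d : nat) :=
  | Read of nat & 'I_d
  | Write of nat & 'I_d.

Section execution.
Context {R : realType} {d n : nat}.
Variables (fs : 'I_n -> 'rV[R]_d -> R) (x0 : 'rV[R]_d) (gamma : R).
Variables (xhat : nat -> 'rV[R]_d) (idx : nat -> 'I_n).
Variable log : nat -> access d.

(* Memory content just before the [k]-th access. *)
Fixpoint memory (k : nat) : 'rV[R]_d :=
  if k is k'.+1 then
    match log k' with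
    | Read _ _ => memory k'
    | Write t v =>
        memory k' - (gamma * grad (fs (idx t)) (xhat t) 0 v) *: delta_mx 0 v
    end
  else x0.

Definition label (a : access d) : nat :=
  match a with Read t _ => t | Write t _ => t end.

Definition read_end (t k : nat) :=
  (exists v, log k = Read t v) /\ forall l v, log l = Read t v -> (l <= k)%N.

(* Iteration [t] is being processed at step [k], i.e. [k] lies between its
   first access (a read) and its last one. *)
Definition processed (t k : nat) :=
  exists k1 k2, [/\ (k1 <= k <= k2)%N, label (log k1) = t
                  & label (log k2) = t].

Record hogwild_execution (tau : nat) : Prop := HogwildExecution {
  read_once : forall t v, exists! k, log k = Read t v ;
  read_value : forall k t v, log k = Read t v -> xhat t 0 v = memory k 0 v ;
  write_once : forall t v, v \in grad_support (fs (idx t)) ->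
    exists! k, log k = Write t v ;
  write_support : forall k t v, log k = Write t v ->
    v \in grad_support (fs (idx t)) ;
  read_before_write : forall k l t v w, log k = Read t v -> log l = Write t w ->
    (k < l)%N ;
  after_read_labels : forall t r k l, (t < r)%N ->
    read_end t k -> read_end r l -> (k < l)%N ;
  bounded_overlap : forall t r k, (t + tau + 1 <= r)%N ->
    ~ (processed t k /\ processed r k) }.

End execution.

Section process.
Context {R : realType} {dO : measure_display} {Omega : measurableType dO}.
Context {d n : nat}.
Variable P : probability Omega R.
Variables (xhat : nat -> Omega -> 'rV[R]_d) (idx : nat -> Omega -> 'I_n).

(* sigma(xhat_u, u <= t; i_u, u < t) *)
Definition past_events (t : nat) : set (set Omega) :=
  <<s [set A | (exists u v (B : set R), [/\ (u <= t)%N, measurable B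
                  & A = (fun w => xhat u w 0 v) @^-1` B])
            \/ (exists u (J : set 'I_n), (u < t)%N /\ A = idx u @^-1` J)] >>.

(* The interleaving [log w] of the accesses is random: it may depend on the
   iterates and on the sampled indices, and need not be measurable. *)
Record hogwild (fs : 'I_n -> 'rV[R]_d -> R) (x0 : 'rV[R]_d) (gamma : R)
    (tau : nat) (log : Omega -> nat -> access d) : Prop := Hogwild {
  measurable_xhat : forall t v, measurable_fun setT (fun w => xhat t w 0 v) ;
  measurable_idx : forall t (J : set 'I_n), measurable (idx t @^-1` J) ;
  idx_uniform : forall t i, P (idx t @^-1` [set i]) = (n%:R^-1)%:E ;
  idx_independent : forall t A (J : set 'I_n), past_events t A ->
    P (A `&` idx t @^-1` J) = (P A * P (idx t @^-1` J))%E ;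
  execution : forall w,
    hogwild_execution fs x0 gamma (xhat^~ w) (idx^~ w) (log w) tau }.

End process.

Section constants.
Context {R : realType}.
Variables (kappa Delta : R) (tau : nat).

Definition xi : R :=
  Num.sqrt (1 + (2 * kappa)^-1 * Num.min (Num.sqrt Delta)^-1 tau%:R).

Definition a_star : R := (5 * (1 + 2 * tau%:R * Num.sqrt Delta) * xi)^-1.

Definition C1 : R := 1 + Num.sqrt Delta * tau%:R.

Definition C2 (mu gamma : R) : R := Num.sqrt Delta + gamma * mu * C1.

End constants.

(* Main.v *)
(* Let [p_t] be the mean of [<g_t - f_{i_t}'(xs), xhat_t - xs>].  Cocoercivity
   gives [E |g_t|^2 <= 2 L p_t + 2 sigma^2], strong convexity gives
   [mu E |xhat_t - xs|^2 <= p_t], and sparsity with the independence of [i_t]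
   from the past gives [E <|g_u|, |g_t|> <= (sqrt Delta / 2)(E |g_u|^2 + E |g_t|^2)]
   for [u <> t].  Hence [E |x_t - xs|^2], plus a sum of the last [tau] values of
   [p] with linearly decreasing weights, contracts by [1 - a / kappa] up to noise.
   That the full rate [gamma mu] is reached, rather than half of it, comes from
   the inequality [mu <= L Delta]: it forces [gamma mu tau <= 1 / 10].

   A read is determined by the sampled indices and by which past updates it
   sees, so [xhat_t] takes finitely many values, and up to a fixed horizon
   expectations are weighted sums over finitely many sample points.  As these sums
   are linear on arbitrary functions, the virtual iterates, which depend on the
   random schedule only through the reads, raise no measurability question. *)

Require Import Defs.
From HB Require Import structures.
From mathcomp Require Import all_boot all_order all_algebra.
From mathcomp Require Import all_classical all_reals all_analysis.
From mathcomp Require Import measurable_realfun ring lra.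

Import Order.TTheory GRing.Theory Num.Theory.
Import numFieldNormedType.Exports.

Local Open Scope classical_set_scope.
Local Open Scope ring_scope.

(** * Smooth convex functions *)

Section euclidean.
Context {R : realType} {d : nat}.
Implicit Types x y z : 'rV[R]_d.

Definition dot x y : R := \sum_(v < d) x 0 v * y 0 v.

Lemma enorm_sqr x : enorm x ^+ 2 = dot x x.
Proof.
rewrite /enorm sqr_sqrtr; first by apply: eq_bigr => v _; rewrite expr2.
by apply: sumr_ge0 => v _; exact: sqr_ge0.
Qed.

Lemma enorm_ge0 x : 0 <= enorm x.
Proof. exact: sqrtr_ge0. Qed.

Lemma dotC x y : dot x y = dot y x.
Proof. by apply: eq_bigr => v _; rewrite mulrC. Qed.

Lemma dotDl x y z : dot (x + y) z = dot x z + dot y z.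
Proof. by rewrite -big_split; apply: eq_bigr => v _; rewrite mxE mulrDl. Qed.

Lemma dotZl (k : R) x y : dot (k *: x) y = k * dot x y.
Proof. by rewrite mulr_sumr; apply: eq_bigr => v _; rewrite mxE mulrA. Qed.

Lemma dotNl x y : dot (- x) y = - dot x y.
Proof. by rewrite -scaleN1r dotZl mulN1r. Qed.

Lemma dotDr x y z : dot x (y + z) = dot x y + dot x z.
Proof. by rewrite dotC dotDl !(dotC x). Qed.

Lemma dotZr (k : R) x y : dot x (k *: y) = k * dot x y.
Proof. by rewrite dotC dotZl dotC. Qed.

Lemma dotNr x y : dot x (- y) = - dot x y.
Proof. by rewrite dotC dotNl dotC. Qed.

Definition dotE := (dotDl, dotDr, dotNl, dotNr, dotZl, dotZr).

Lemma dot_ge0 x : 0 <= dot x x.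
Proof. by rewrite -enorm_sqr sqr_ge0. Qed.

Lemma dot_young (l : R) x y : 0 < l ->
  2 * dot x y <= l * dot x x + l^-1 * dot y y.
Proof.
move=> l0; have := dot_ge0 (l *: x - y); rewrite !dotE (dotC y x) => h.
have : 0 <= l^-1 * (l * (l * dot x x) - l * dot x y -
  (l * dot x y - dot y y)).
  by rewrite mulr_ge0 ?invr_ge0 ?(ltW l0)//; lra.
rewrite (_ : l^-1 * _ = l * dot x x + l^-1 * dot y y - 2 * dot x y); first lra.
by field; rewrite gt_eqF.
Qed.

Lemma abs_coord_le_enorm x v : `|x 0 v| <= enorm x.
Proof.
rewrite -sqrtr_sqr ler_wsqrtr// (bigD1 v)//= lerDl.
by apply: sumr_ge0 => ? _; exact: sqr_ge0.
Qed.

End euclidean.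

(** * Tangent inequalities and cocoercivity of gradients *)

Section smooth_convex.
Context {R : realType} {d : nat}.
Implicit Types (x y z : 'rV[R]_d) (h : 'rV[R]_d -> R).

Lemma derive_dot_grad h x y : differentiable h x ->
  'D_y h x = dot (grad h x) y.
Proof.
move=> dh; rewrite deriveE//.
rewrite {1}(row_sum_delta y) linear_sum; apply: eq_bigr => v _.
by rewrite linearZ /= mxE deriveE// mulrC.
Qed.

(** The remainder [s * K] vanishes as [s] decreases to 0, so the bound on difference quotients
    survives in the limit. Strong convexity and minimality both reach the gradient this way. *)
Lemma dot_grad_le_slope h x y (M K : R) : differentiable h x ->
  (forall s : R, 0 < s < 1 -> h (x + s *: y) - h x <= s * (M + s * K)) ->
  dot (grad h x) y <= M.
Proof.
move=> dh hM; rewrite -derive_dot_grad//.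
have /cvg_ex [l hl] : derivable h x y by exact: diff_derivable.
have -> : 'D_y h x = l by apply/cvg_lim.
have /cvg_dnbhs_at_right hr := hl.
have hK : (s * K : R) @[s --> (0:R)^'+] --> (0 : R).
  rewrite -[X in _ --> X](mul0r K); apply: cvgM; last exact: cvg_cst.
  exact/cvg_at_right_filter/cvg_id.
have hq : (s^-1 * (h (s *: y + x) - h x) - s * K : R) @[s --> (0:R)^'+] --> (l : R).
  by have := cvgB hr hK; rewrite subr0; apply.
apply: (cvgr_to_le hq); near=> s.
have s0 : 0 < s by [].
have s1 : s < 1 by near: s; exact: nbhs_right_lt.
rewrite lerBlDr ler_pdivrMl// [_ + x]addrC.
by rewrite hM// s0.
Unshelve. all: by end_near. Qed.

Lemma strongly_convex_ge_tangent (mu : R) h x y : differentiable h x ->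
  strongly_convex mu h ->
  h x + dot (grad h x) (y - x) + mu / 2 * dot (y - x) (y - x) <= h y.
Proof.
move=> dh hsc.
rewrite -lerBrDr -lerBrDl.
(* On the segment, strong convexity gains (mu/2) s (1 - s) |y - x|^2; its part quadratic in [s] is
   the [K] term. *)
apply: (@dot_grad_le_slope _ _ _ _ (mu / 2 * dot (y - x) (y - x))) => //.
move=> s /andP[s0 s1].
have := hsc (Itv01 (ltW s0) (ltW s1)) y x; rewrite !inE => /(_ I I).
rewrite convRE /= /unstable.onem.
set w := (X in h X - _); have -> : w = x + s *: (y - x).
  by rewrite /w /conv /= /unstable.onem scalerBl scale1r scalerBr addrC addrAC -addrA.
rewrite !enorm_sqr !dotE (dotC y x).
rewrite /unstable.onem /=.
move: (dot x x) (dot x y) (dot y y) => xx xy yy.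
move: (h (x + s *: (y - x))) (h x) (h y) => a b c H.
lra.
Qed.

Lemma convex_strongly_convex0 h : convex_function setT h ->
  strongly_convex 0 h.
Proof.
move=> hc; rewrite /strongly_convex.
by rewrite (_ : (fun x => _) = h)//; apply/funext => x; rewrite !mul0r subr0.
Qed.

Lemma is_derive_line h x y (s : R) : differentiable h (s *: y + x) ->
  is_derive s 1 (fun s : R => h (s *: y + x)) (dot (grad h (s *: y + x)) y).
Proof.
move=> dh; rewrite -derive_dot_grad//.
have dhy := @diff_derivable _ _ _ _ _ y dh.
have E : (fun k => k^-1 *: (((fun s : R => h (s *: y + x)) \o shift s) (k *: 1)
     - h (s *: y + x))) =
   (fun k => k^-1 *: ((h \o shift (s *: y + x)) (k *: y) - h (s *: y + x))).
  by apply/funext => k /=; rewrite [k *: 1]mulr1 scalerDl addrA.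
by split; rewrite /derivable /derive E.
Qed.

(** Subtracting the parabola from [h] along the segment leaves [psi], whose derivative is
    nonpositive by the Lipschitz bound; the mean value theorem compares its ends. *)
Lemma le_tangent_quadratic (L : R) h x y : 0 < L ->
  (forall z, differentiable h z) -> lipschitz_grad L h ->
  h y <= h x + dot (grad h x) (y - x) + L / 2 * dot (y - x) (y - x).
Proof.
move=> L0 dh hL; set z := y - x.
pose phi (s : R) := h (s *: z + x).
pose psi : R -> R := phi - (fun s : R => s * dot (grad h x) z + s ^+ 2 * (L / 2 * dot z z)).
pose dpsi (s : R) := dot (grad h (s *: z + x)) z -
  (dot (grad h x) z + s * (L * dot z z)).
have dp (s : R) : is_derive s 1 psi (dpsi s).
  apply: is_deriveB; first exact: is_derive_line.
  apply: is_derive_eq.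
  by rewrite !scaler0 !add0r /GRing.scale /=; field.
have [||c] := @MVT _ psi dpsi 0 1 _ (fun s _ => dp s).
- by [].
- by apply: derivable_within_continuous => s _; exact: (@ex_derive _ _ _ _ _ _ _ (dp s)).
rewrite in_itv/= => /andP[c0 c1].
rewrite subr0 mulr1 /psi /phi => hp.
suff : dpsi c <= 0.
  rewrite -hp !fctE scale1r scale0r add0r /z subrK. lra.
rewrite /dpsi.
(* With this weight both terms of Young's inequality are at most L c |z|^2, as the gradients differ
   by at most L c |z|. *)
have Lc : 0 < (L * c)^-1 by rewrite invr_gt0 mulr_gt0.
have := dot_young _ (grad h (c *: z + x) - grad h x) z Lc.
have := hL (c *: z + x) x; rewrite addrK => hl.
have : enorm (grad h (c *: z + x) - grad h x) ^+ 2 <= (L * enorm (c *: z)) ^+ 2.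
  by rewrite ler_sqr ?nnegrE ?enorm_ge0// (le_trans (enorm_ge0 _) hl).
rewrite exprMn !enorm_sqr !dotZl !dotZr => h1 h2.
rewrite dotDl dotNl in h2.
have h3 : (L * c)^-1 * dot (grad h (c *: z + x) - grad h x) (grad h (c *: z + x) - grad h x)
   <= L * c * dot z z.
  rewrite ler_pdivrMl ?mulr_gt0// (le_trans h1)//.
  by rewrite le_eqVlt; apply/orP; left; apply/eqP; ring.
by rewrite invrK in h2; lra.
Qed.

(** The tangent at [u] lies below the quadratic majorant at [w]; comparing them at one well-chosen
    point gives [key]. Adding [key] in both orders cancels the function values. *)
Lemma grad_cocoercive (L : R) h x y : 0 < L ->
  (forall z, differentiable h z) -> lipschitz_grad L h ->
  convex_function setT h ->
  let g := grad h x - grad h y in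
  dot g g <= L * dot g (x - y).
Proof.
move=> L0 dh hL hc /=; set g := grad h x - grad h y.
have key u w : let g := grad h u - grad h w in
    dot g g <= 2 * L * (h w - h u - dot (grad h u) (w - u)).
  (* This [z] minimises the majorant at [w] minus the tangent at [u]. *)
  rewrite /= {g}; set z := w + L^-1 *: (grad h u - grad h w).
  have /convex_strongly_convex0 hc0 := hc.
  have := strongly_convex_ge_tangent 0 h u z (dh u) hc0.
  have := le_tangent_quadratic L h w z L0 dh hL.
  have -> : z - w = L^-1 *: (grad h u - grad h w) by rewrite /z addrC addKr.
  have -> : z - u = (w - u) + L^-1 *: (grad h u - grad h w).
    by rewrite /z addrAC.
  set gu := grad h u; set gw := grad h w; set e := w - u.
  rewrite !mul0r addr0 (dotDr gu) !dotZr !dotZl => h1 h2.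
  have h3 := le_trans h2 h1.
  have {h3} : dot (gu - gw) (gu - gw) / (2 * L) <= h w - h u - dot gu e.
    have -> : dot (gu - gw) (gu - gw) / (2 * L) =
       L^-1 * dot gu (gu - gw) - L^-1 * dot gw (gu - gw) -
       L / 2 * (L^-1 * (L^-1 * dot (gu - gw) (gu - gw))).
      rewrite !dotE; field; rewrite gt_eqF//.
    lra.
  by rewrite ler_pdivrMr ?mulr_gt0// => h3; rewrite (le_trans h3)// mulrC.
have := key x y; have := key y x => /=.
have -> : grad h y - grad h x = - g by rewrite opprB.
rewrite dotNl dotNr opprK -/g => h1 h2.
have -> : dot g (x - y) = dot (grad h x) (x - y) - dot (grad h y) (x - y).
  by rewrite dotDl dotNl.
by move: h1 h2; rewrite -(opprB x y) dotNr; lra.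
Qed.

End smooth_convex.

(** * Mean objective and sparsity *)

Section mean_objective.
Context {R : realType} {d n : nat}.
Variables (fs : 'I_n -> 'rV[R]_d -> R).
Hypothesis hdiff : forall i x, differentiable (fs i) x.
Implicit Types x y : 'rV[R]_d.

Let mean_objE : mean_obj fs = n%:R^-1 \*: (\sum_(i < n) fs i).
Proof. by apply/funext => x; rewrite /mean_obj /= fct_sumE. Qed.

Lemma differentiable_mean_obj x : differentiable (mean_obj fs) x.
Proof.
by rewrite mean_objE; apply: differentiableZ; exact: differentiable_sum.
Qed.

Lemma dot_grad_mean_obj x y :
  dot (grad (mean_obj fs) x) y = n%:R^-1 * \sum_i dot (grad (fs i) x) y.
Proof.
rewrite -derive_dot_grad; last exact: differentiable_mean_obj.
have hd i : derivable (fs i) x y by exact: diff_derivable.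
rewrite mean_objE deriveZ; last exact: derivable_sum.
rewrite derive_sum//; congr (_ * _).
by apply: eq_bigr => i _; rewrite derive_dot_grad.
Qed.

Lemma mean_grad_strongly_monotone (mu : R) x y :
  strongly_convex mu (mean_obj fs) ->
  mu * dot (x - y) (x - y) <=
  n%:R^-1 * \sum_i dot (grad (fs i) x - grad (fs i) y) (x - y).
Proof.
move=> hsc; under eq_bigr do rewrite dotDl dotNl.
rewrite sumrB mulrBr -!dot_grad_mean_obj.
have := strongly_convex_ge_tangent mu _ x y (differentiable_mean_obj x) hsc.
have := strongly_convex_ge_tangent mu _ y x (differentiable_mean_obj y) hsc.
by rewrite -(opprB x y) !dotNr !dotNl; lra.
Qed.

(** First-order optimality: along any segment from [xs], the negated objective has nonpositive
    slopes. *)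
Lemma mean_grad_minimizer_ge0 xs x :
  (forall y, mean_obj fs xs <= mean_obj fs y) ->
  0 <= n%:R^-1 * \sum_i dot (grad (fs i) xs) (x - xs).
Proof.
move=> hxs; rewrite -dot_grad_mean_obj -oppr_le0 -dotNl.
have gN : - grad (mean_obj fs) xs = grad (\- mean_obj fs) xs.
  apply/rowP => v; rewrite !mxE deriveN//.
  exact/diff_derivable/differentiable_mean_obj.
rewrite gN; apply: (@dot_grad_le_slope _ _ _ _ _ _ 0).
  exact/differentiableN/differentiable_mean_obj.
move=> s s01; rewrite add0r !mulr0 /=; have := hxs (xs + s *: (x - xs)).
lra.
Qed.

End mean_objective.

(** * Supports of the gradients and the sparsity constant *)

Section sparsity.
Context {R : realType} {d n : nat}.
Variables (fs : 'I_n -> 'rV[R]_d -> R).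
Hypothesis hn : (0 < n)%N.

Lemma grad_support_eq0 (h : 'rV[R]_d -> R) x v :
  v \notin grad_support h -> grad h x 0 v = 0.
Proof.
rewrite inE => /asboolP hv; apply/eqP/negPn/negP => h0.
by apply: hv; exists x.
Qed.

(** The left side is the probability that a uniformly sampled summand touches coordinate [v]. *)
Lemma mean_support_le_sparsity v :
  n%:R^-1 * \sum_(i < n) (v \in grad_support (fs i))%:R <= sparsity fs.
Proof.
rewrite /sparsity mulrC ler_pM2r ?invr_gt0 ?ltr0n//.
rewrite -natr_sum ler_nat -big_mkcond /= sum1_card.
set c := (X in (X <= _)%N).
have -> : c = #|[set i | v \in grad_support (fs i)]%SET|.
  by rewrite cardsE.
exact: (@leq_bigmax _ (fun v : 'I_d => #|[set i | v \in grad_support (fs i)]%SET|) v).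
Qed.

Lemma sparsity_ge0 : 0 <= sparsity fs.
Proof. by rewrite divr_ge0. Qed.

Lemma sparsity_le1 : sparsity fs <= 1.
Proof.
rewrite ler_pdivrMr ?ltr0n// mul1r ler_nat.
apply/bigmax_leqP => v _.
by rewrite -[leqRHS]card_ord max_card.
Qed.

(* Only a fraction [sparsity fs] of the summands contributes to the curvature
   of the mean along a coordinate axis, and each of them at most [L]. *)
Lemma strong_convexity_le_sparsity (L mu : R) : (0 < d)%N ->
  (forall i x, differentiable (fs i) x) ->
  (forall i, lipschitz_grad L (fs i)) -> strongly_convex mu (mean_obj fs) ->
  mu <= L * sparsity fs.
Proof.
move=> d0 hdiff hlip hsc; pose v := Ordinal d0.
pose e : 'rV[R]_d := delta_mx 0 v.
have dote (x : 'rV[R]_d) : dot x e = x 0 v.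
  rewrite /dot (bigD1 v)//= mxE !eqxx mulr1 big1 ?addr0// => w wv.
  by rewrite mxE (negbTE wv) andbF mulr0.
have enorme : enorm e = 1.
  by rewrite -[LHS]ger0_norm ?enorm_ge0// -sqrtr_sqr enorm_sqr dote mxE !eqxx sqrtr1.
have L0 : 0 <= L.
  have := hlip (Ordinal hn) e 0; rewrite subr0 enorme mulr1; apply: le_trans.
  exact: enorm_ge0.
have := mean_grad_strongly_monotone _ hdiff mu e 0 hsc.
rewrite subr0 dote mxE !eqxx mulr1 => /le_trans; apply.
apply: le_trans (ler_wpM2l L0 (mean_support_le_sparsity v)).
rewrite mulrCA ler_wpM2l ?invr_ge0 ?ler0n// mulr_sumr ler_sum// => i _.
rewrite dote; case: (boolP (v \in _)) => hv.
  rewrite mulr1 (le_trans (ler_norm _))//.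
  rewrite (le_trans (abs_coord_le_enorm _ _))// (le_trans (hlip i _ _))//.
  by rewrite subr0 enorme mulr1.
by rewrite mxE [X in _ + X]mxE !grad_support_eq0// subrr mulr0.
Qed.

End sparsity.

(** * Inconsistent reads of an execution *)

Section execution_views.
Context {R : realType} {d n : nat}.
Variables (fs : 'I_n -> 'rV[R]_d -> R) (x0 : 'rV[R]_d) (gamma : R).
Variables (xhat : nat -> 'rV[R]_d) (idx : nat -> 'I_n).
Variables (log : nat -> access d) (tau : nat).
Hypothesis d0 : (0 < d)%N.
Hypothesis H : hogwild_execution fs x0 gamma xhat idx log tau.

Let gr u := grad (fs (idx u)) (xhat u).

Let written (v : 'I_d) (k u : nat) : bool :=
  `[< exists2 l, (l < k)%N & log l = Write u v >].

(** Each write to [v] subtracts one term, and by [write_once] no term is subtracted twice, so one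
    bit per iteration describes the content. *)
Lemma memory_coordE (v : 'I_d) (k N : nat) :
  (forall l u, (l < k)%N -> log l = Write u v -> (u < N)%N) ->
  memory fs x0 gamma xhat idx log k 0 v =
  x0 0 v - gamma * \sum_(u < N) (written v k u)%:R * gr u 0 v.
Proof.
elim: k => [_ /=|k IH hN /=].
  rewrite big1 ?mulr0 ?subr0// => u _; rewrite /written asboolF ?mul0r//.
  by case.
have {}IH := IH (fun l u lk => hN l u (ltnW lk)).
have skip : (forall u, log k <> Write u v) ->
    forall u, written v k.+1 u = written v k u.
  move=> hk u; apply: asbool_equiv_eq; split=> -[l lk hl].
    exists l => //; move: lk; rewrite ltnS leq_eqVlt => /orP[/eqP lk|//].
    by move: hl; rewrite lk => /hk.
  by exists l => //; exact: leq_trans lk _.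
case E : (log k) => [u w|u w].
  rewrite IH; congr (_ - _ * _); apply: eq_bigr => r _; rewrite skip// => r'.
  by rewrite E.
rewrite !mxE IH; case: (eqVneq w v) => wv; last first.
  rewrite andbF /= mulr0 subr0.
  congr (_ - _ * _); apply: eq_bigr => r _; rewrite skip// => r'.
  by rewrite E => -[_ /eqP]; rewrite (negbTE wv).
move: E; rewrite wv => E; rewrite eqxx mulr1.
have uN : (u < N)%N by exact: hN (ltnSn k) E.
rewrite (bigD1 (Ordinal uN))//= [in RHS](bigD1 (Ordinal uN))//=.
have -> : written v k u = false.
  apply: asboolF => -[l lk hl].
  have [k' [_ hk']] := write_once H (write_support H E).
  by move: lk; rewrite -(hk' _ hl) -(hk' _ E) ltnn.
have -> : written v k.+1 u by apply/asboolP; exists k.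
rewrite mul0r add0r mul1r.
set S1 := \sum_(i < N | _) _; set S2 := \sum_(i < N | _) _.
suff -> : S1 = S2 by rewrite /gr [grad _ _ 0 v]mxE; ring.
apply: eq_bigr => r ru; congr ((nat_of_bool _)%:R * _).
apply: asbool_equiv_eq; split=> -[l lk hl].
  by exists l => //; exact: leq_trans lk _.
exists l => //; move: lk; rewrite ltnS leq_eqVlt => /orP[/eqP lk|//].
move: hl; rewrite lk E => -[ur]; move: ru; rewrite -val_eqE /= ur.
by rewrite eqxx.
Qed.

Lemma read_end_exists t : exists k, read_end log t k.
Proof.
have /choice [f hf] : forall v, exists k, log k = Read t v.
  by move=> v; have [k [hk _]] := read_once H t v; exists k.
have [|v hv] := @bigop.eq_bigmax _ f; first by rewrite card_ord.
exists (f v); split; first by exists v.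
move=> l w hl; have [k [_ hk]] := read_once H t w.
by rewrite -(hk _ hl) (hk _ (hf w)) -hv leq_bigmax.
Qed.

(** A write of [u] follows the end of the read of [u]. For [u] after [t], this end comes later than
    every read of [t]; for [u = t], [read_before_write] is violated. *)
Lemma write_before_read_label t u k l v w :
  log k = Read t v -> log l = Write u w -> (l < k)%N -> (u < t)%N.
Proof.
move=> hk hl lk.
have [ku [[u' hu] hu2]] := read_end_exists u.
have [kt [[t' ht] ht2]] := read_end_exists t.
have kul : (ku < l)%N by exact: (read_before_write H hu hl).
have kkt : (k <= kt)%N := ht2 _ _ hk.
rewrite ltnNge; apply/negP; rewrite leq_eqVlt => /orP[/eqP tu|tu].
  move: hl; rewrite -tu => hl.
  by have := read_before_write H hk hl; rewrite ltnNge ltnW.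
have ru : read_end log u ku by split => //; exists u'.
have rt : read_end log t kt by split => //; exists t'.
have := after_read_labels H tu rt ru.
by rewrite ltnNge ltnW// (ltn_trans kul)// (leq_trans lk).
Qed.

(** Were the write later than the read, both iterations would be in progress at the later of [k] and
    the end [ku] of the read of [u]. *)
Lemma old_write_before_read t u k l v w : (u + tau + 1 <= t)%N ->
  log k = Read t v -> log l = Write u w -> (l < k)%N.
Proof.
move=> ut hk hl.
have [ku [[u' hu] hu2]] := read_end_exists u.
have [kt [[t' ht] ht2]] := read_end_exists t.
have ru : read_end log u ku by split => //; exists u'.
have rt : read_end log t kt by split => //; exists t'.
have ult : (u < t)%N by rewrite (leq_trans _ ut)// addn1 ltnS leq_addr.
have kukt := after_read_labels H ult ru rt.
have kul : (ku < l)%N by exact: (read_before_write H hu hl).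
rewrite ltnNge; apply/negP => kl.
case: (leqP k ku) => [kku|kuk].
  apply: (bounded_overlap H ut (k := ku)); split.
    by exists ku, ku; rewrite hu leqnn.
  by exists k, kt; rewrite hk ht kku ltnW.
apply: (bounded_overlap H ut (k := k)); split.
  by exists ku, l; rewrite hu hl kl ltnW.
by exists k, k; rewrite hk leqnn.
Qed.

(** The bit [c u] tells whether coordinate [v] of update [u] has reached memory; it is one minus the
    entry at [v] of the mask of missing updates. *)
Lemma read_partial_updates t v : exists c : nat -> bool,
  xhat t 0 v = x0 0 v - gamma * \sum_(u < t) (c u)%:R * gr u 0 v /\
  forall u, (u + tau < t)%N -> c u || (gr u 0 v == 0).
Proof.
have [k [hk _]] := read_once H t v.
exists (written v k); split.
  rewrite (read_value H hk) (@memory_coordE v k t)// => l u lk hl.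
  exact: write_before_read_label hk hl lk.
move=> u ut; case: (boolP (v \in grad_support (fs (idx u)))) => hv; last first.
  by rewrite grad_support_eq0// eqxx orbT.
have [l [hl _]] := write_once H hv.
apply/orP; left; apply/asboolP; exists l => //.
by apply: old_write_before_read hk hl; rewrite addn1.
Qed.

Lemma read_error_le t v : 0 <= gamma ->
  `|xhat t 0 v - (x0 0 v - gamma * \sum_(u < t) gr u 0 v)| <=
  gamma * \sum_(u < t) (t - u <= tau)%:R * `|gr u 0 v|.
Proof.
move=> g0; have [c [-> hc]] := read_partial_updates t v.
have -> : x0 0 v - gamma * \sum_(u < t) (c u)%:R * gr u 0 v -
    (x0 0 v - gamma * \sum_(u < t) gr u 0 v) =
    gamma * \sum_(u < t) (1 - (c u)%:R) * gr u 0 v.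
  rewrite [in RHS](eq_bigr (fun u : 'I_t => gr u 0 v - (c u)%:R * gr u 0 v)).
    by rewrite sumrB; ring.
  by move=> u _; rewrite mulrBl mul1r.
rewrite normrM ger0_norm// ler_wpM2l// (le_trans (ler_norm_sum _ _ _))//.
apply: ler_sum => u _; rewrite normrM; case: (leqP (t - u) tau) => hu.
  by rewrite ler_wpM2r//; case: (c u); rewrite ?subrr ?subr0 ?normr0 ?normr1.
have ut : (u + tau < t)%N by rewrite -ltn_subRL.
have /orP[->|/eqP ->] := hc _ ut; first by rewrite subrr normr0 !mul0r.
by rewrite normr0 !mulr0.
Qed.

End execution_views.

(** * Random elements of finite range *)

Lemma uniq_map_injective {T T' : eqType} (f : T -> T') (s : seq T) :
  uniq (map f s) -> {in s &, injective f}.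
Proof.
elim: s => [|x s IH] //= /andP[fx /IH {}IH] y z.
rewrite !inE => /predU1P[->|ys] /predU1P[->|zs] // E.
- by move: fx; rewrite E map_f.
- by move: fx; rewrite -E map_f.
- exact: IH.
Qed.

Section finite_range.
Context {O : Type}.

Lemma finite_range_map_seq {I : eqType} {T : Type} (F : I -> O -> T)
    (s : seq I) :
  (forall i, i \in s -> finite_set (range (F i))) ->
  finite_set (range (fun w => [seq F i w | i <- s])).
Proof.
elim: s => [_|i s IH h] /=; first exact: finite_image_cst.
apply: finite_image11; first by apply: h; rewrite mem_head.
by apply: IH => j js; apply: h; rewrite inE js orbT.
Qed.

Lemma finite_range_factor {T T' : Type} (Y : O -> T) (Z : O -> T')
    (f : T -> T') : (forall w, Z w = f (Y w)) ->
  finite_set (range Y) -> finite_set (range Z).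
Proof.
move=> ZE fY; have -> : range Z = f @` (range Y).
  by rewrite image_comp; congr (_ @` _); exact/funext.
exact: finite_image.
Qed.

(** One preimage is chosen for each value, so that sums over the values of [Z] become sums over
    sample points. *)
Lemma finite_range_samples {T : eqType} (Z : O -> T) : finite_set (range Z) ->
  exists2 ws : seq O, uniq (map Z ws) & forall w, Z w \in map Z ws.
Proof.
move=> /finite_seqP[s sE].
have hs z : z \in s -> exists w, Z w = z.
  by move=> zs; have [w _ wz] : range Z z; [rewrite sE|exists w].
suff [ws wsE] : exists ws, map Z ws = undup s.
  exists ws; first by rewrite wsE undup_uniq.
  move=> w; rewrite wsE mem_undup.
  have : range Z (Z w) by exists w.
  by rewrite sE.
have {}hs z : z \in undup s -> exists w, Z w = z by rewrite mem_undup; exact: hs.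
elim: (undup s) hs => [_|z r IH hs]; first by exists [::].
have [|ws wsE] := IH; first by move=> y yr; apply: hs; rewrite inE yr orbT.
have [|w wE] := hs z; first by rewrite mem_head.
by exists (w :: ws); rewrite /= wE wsE.
Qed.

End finite_range.

(** * Measurability through fibers *)

Section measurable_fibers.
Context {dO : measure_display} {O : measurableType dO}.

(** This form of measurability, adequate for maps of finite range, presupposes no sigma-algebra on
    [T]. *)
Definition measurable_fibers {T : Type} (Z : O -> T) :=
  forall z, measurable (Z @^-1` [set z]).

Lemma measurable_fibers_pair {T T' : Type} (Y : O -> T) (Z : O -> T') :
  measurable_fibers Y -> measurable_fibers Z ->
  measurable_fibers (fun w => (Y w, Z w)).
Proof.
move=> mY mZ [y z].
have -> : (fun w => (Y w, Z w)) @^-1` [set (y, z)] =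
    Y @^-1` [set y] `&` Z @^-1` [set z].
  by apply/seteqP; split=> w /= [-> ->].
exact: measurableI.
Qed.

(** Nonempty fibers depend only on the partition that the map induces. *)
Lemma measurable_fibers_equiv {T T' : Type} (Y : O -> T) (Z : O -> T') :
  (forall w w', Y w = Y w' <-> Z w = Z w') ->
  measurable_fibers Y -> measurable_fibers Z.
Proof.
move=> YZ mY z; have [[w <-]|hz] := pselect (exists w, Z w = z).
  have -> : Z @^-1` [set Z w] = Y @^-1` [set Y w]; last exact: mY.
  by apply/seteqP; split=> w' /= /YZ.
have -> : Z @^-1` [set z] = set0; last exact: measurable0.
by apply/seteqP; split=> w //= zw; apply: hz; exists w.
Qed.

Lemma measurable_fibers_map_seq {I : eqType} {T : Type} (F : I -> O -> T)
    (s : seq I) :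
  (forall i, i \in s -> measurable_fibers (F i)) ->
  measurable_fibers (fun w => [seq F i w | i <- s]).
Proof.
elim: s => [_|i s IH h] /=.
  move=> z; have [->|hz] := pselect (z = [::]).
    have -> : (fun=> [::] : seq T) @^-1` [set [::]] = [set: O].
      by apply/seteqP; split.
    exact: measurableT.
  have -> : (fun=> [::] : seq T) @^-1` [set z] = set0 :> set O; last exact: measurable0.
  by apply/seteqP; split=> // w /= zw; apply: hz.
apply: (@measurable_fibers_equiv _ _ (fun w => (F i w, [seq F j w | j <- s]))).
  by move=> w w'; split=> -[-> ->].
apply: measurable_fibers_pair; first by apply: h; rewrite mem_head.
by apply: IH => j js; apply: h; rewrite inE js orbT.
Qed.

Lemma measurable_fibers_row {R : realType} {d : nat} (X : O -> 'rV[R]_d) :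
  (forall v, measurable_fibers (fun w => X w 0 v)) -> measurable_fibers X.
Proof.
move=> mX.
apply: (@measurable_fibers_equiv _ _ (fun w => [seq X w 0 v | v <- enum 'I_d])).
  move=> w w'; split=> [/eq_in_map h|->//].
  by apply/rowP => v; apply: h; rewrite mem_enum.
by apply: (measurable_fibers_map_seq (fun v w => X w 0 v)) => v _.
Qed.

End measurable_fibers.

(** * Expectation as a finite weighted sum *)

Section finite_expectation.
Context {R : realType} {dO : measure_display} {O : measurableType dO}.
Variable P : probability O R.

Definition sample_mean (ws : seq O) (p X : O -> R) : R :=
  \sum_(w <- ws) p w * X w.

(** As [X] factors through [Z], it is a finite combination of indicators of fibers, with its values
    at the representatives as coefficients. *)
Lemma expectation_sample_mean {T : eqType} (Z : O -> T) (ws : seq O)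
    (X : O -> R) :
  uniq (map Z ws) -> (forall w, Z w \in map Z ws) -> measurable_fibers Z ->
  (forall w, 0 <= X w) -> (forall w w', Z w = Z w' -> X w = X w') ->
  ('E_P[X] =
   (sample_mean ws (fun w => fine (P (Z @^-1` [set Z w]))) X)%:E)%E.
Proof.
move=> uws hws mZ X0 XZ.
have XE w : (X w)%:E = (\sum_(w' <- ws) (X w')%:E * (\1_(Z @^-1` [set Z w']) w)%:E)%E.
  have /mapP[w0 w0ws w0E] := hws w.
  have uw : uniq ws by exact: map_uniq uws.
  rewrite (bigD1_seq w0)//= indicE mem_set//= mule1 (XZ _ _ w0E).
  rewrite big1_seq ?adde0// => w' /andP[w'w0 w'ws].
  rewrite indicE memNset ?mule0//= => ZE.
  move/eqP: w'w0; apply; apply: (uniq_map_injective _ _ uws) => //.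
  by rewrite -ZE.
rewrite unlock; under eq_integral do rewrite XE.
rewrite ge0_integral_sum//; last 2 first.
- move=> w'; apply/measurable_EFinP.
  by apply: measurable_funM => //; exact: measurable_indic.
- by move=> w' w _; rewrite lee_fin mulr_ge0.
rewrite /sample_mean -sumEFin; apply: eq_bigr => w' _.
rewrite ge0_integralZl_EFin//; last first.
  by apply/measurable_EFinP; exact: measurable_indic.
rewrite integral_indic// setIT EFinM fineK; last exact: fin_num_measure.
exact: muleC.
Qed.

Variables (ws : seq O) (p : O -> R).
Hypothesis p0 : forall w, 0 <= p w.
Let E := sample_mean ws p.

Lemma sample_mean_le (X Y : O -> R) : (forall w, X w <= Y w) -> E X <= E Y.
Proof. by move=> XY; apply: ler_sum => w _; rewrite ler_wpM2l. Qed.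

Lemma sample_mean_ge0 (X : O -> R) : (forall w, 0 <= X w) -> 0 <= E X.
Proof. by move=> X0; apply: sumr_ge0 => w _; rewrite mulr_ge0. Qed.

Lemma eq_sample_mean (X Y : O -> R) : (forall w, X w = Y w) -> E X = E Y.
Proof. by move=> XY; apply: eq_bigr => w _; rewrite XY. Qed.

Lemma sample_meanD (X Y : O -> R) : E (fun w => X w + Y w) = E X + E Y.
Proof. by rewrite -big_split; apply: eq_bigr => w _; rewrite mulrDr. Qed.

Lemma sample_meanZ (k : R) (X : O -> R) : E (fun w => k * X w) = k * E X.
Proof. by rewrite mulr_sumr; apply: eq_bigr => w _; rewrite mulrCA. Qed.

Lemma sample_mean_sum {I : Type} (s : seq I) (F : I -> O -> R) :
  E (fun w => \sum_(i <- s) F i w) = \sum_(i <- s) E (F i).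
Proof.
by rewrite exchange_big; apply: eq_bigr => w _; rewrite mulr_sumr.
Qed.

(* [Z] refines the conditioning variable [Y] and the index [I]; sample means
   agree with expectations on nonnegative functions of [Z]. *)
Lemma sample_mean_independent {n : nat} {T T' : eqType} (Z : O -> T)
    (Y : O -> T') (I : O -> 'I_n) (H : 'I_n -> O -> R) :
  (forall X : O -> R, (forall w, 0 <= X w) ->
     (forall w w', Z w = Z w' -> X w = X w') -> ('E_P[X] = (E X)%:E)%E) ->
  (forall w w', Z w = Z w' -> Y w = Y w' /\ I w = I w') ->
  finite_set (range Y) -> measurable_fibers Y -> measurable_fibers I ->
  (forall y i, (P (Y @^-1` [set y] `&` I @^-1` [set i]) =
     P (Y @^-1` [set y]) * (n%:R^-1)%:E)%E) ->
  (forall i w w', Y w = Y w' -> H i w = H i w') ->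
  E (fun w => H (I w) w) = E (fun w => n%:R^-1 * \sum_i H i w).
Proof.
move=> hE hZ fY mY mI ind HY.
have [ys uys hys] := finite_range_samples Y fY.
have EY y : E (\1_(Y @^-1` [set y])) = fine (P (Y @^-1` [set y])).
  rewrite -expectation_indic// hE// => w w' /hZ[YE _].
  by rewrite !indicE; congr (nat_of_bool _)%:R; rewrite /in_mem /= /in_set /= YE.
have EYI y i : E (\1_(Y @^-1` [set y] `&` I @^-1` [set i])) =
    n%:R^-1 * E (\1_(Y @^-1` [set y])).
  have mYI : measurable (Y @^-1` [set y] `&` I @^-1` [set i]).
    exact: measurableI.
  have <- : fine 'E_P[\1_(Y @^-1` [set y] `&` I @^-1` [set i])]%E =
    E (\1_(Y @^-1` [set y] `&` I @^-1` [set i])).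
    rewrite hE// => w w' /hZ[YE IE].
    by rewrite !indicE; congr (nat_of_bool _)%:R; rewrite /in_mem /= /in_set /= YE IE.
  rewrite expectation_indic// ind EY fineM//; last exact: fin_num_measure.
  by rewrite mulrC.
have sumY (F : O -> R) w : (forall w w', Y w = Y w' -> F w = F w') ->
    F w = \sum_(y <- ys) F y * \1_(Y @^-1` [set Y y]) w.
  move=> FY; have /mapP[y yys yE] := hys w.
  rewrite (bigD1_seq y)//=; last exact: map_uniq uys.
  rewrite indicE mem_set//= mulr1 (FY _ _ yE) big1_seq ?addr0//.
  move=> y' /andP[y'y y'ys]; rewrite indicE memNset ?mulr0//= => YE.
  move/eqP: y'y; apply; apply: (uniq_map_injective _ _ uys) => //.
  by rewrite -YE.
(* Both means reduce to this double sum, with [H i] frozen at a representative of each fiber of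
   [Y]. *)
transitivity (\sum_(y <- ys) \sum_i H i y * (n%:R^-1 * E (\1_(Y @^-1` [set Y y])))).
  under eq_bigr => y _ do under eq_bigr => i _ do
    rewrite -(EYI _ i) -sample_meanZ.
  under eq_bigr do rewrite -sample_mean_sum.
  rewrite -sample_mean_sum; apply: eq_sample_mean => w.
  rewrite (sumY (H (I w)) w (HY _)); apply: eq_bigr => y _.
  rewrite (bigD1 (I w))//= big1 ?addr0 => [|i iI].
    congr (_ * _); rewrite !indicE; congr (nat_of_bool _)%:R.
    by apply/idP/idP; rewrite !inE /= => h; [split|case: h].
  by rewrite indicE memNset ?mulr0//= => -[_ h]; move: iI; rewrite h eqxx.
rewrite sample_meanZ sample_mean_sum mulr_sumr exchange_big; apply: eq_bigr => i _.
rewrite -[in RHS](eq_sample_mean _ _ (fun w => esym (sumY (H i) w (HY i)))).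
rewrite sample_mean_sum mulr_sumr; apply: eq_bigr => y _.
by rewrite sample_meanZ mulrCA.
Qed.

End finite_expectation.

(** * Lyapunov recursion *)

Section lyapunov.
Context {R : realType}.
Variables (tau : nat).

(** Filtering [u < t] by age also covers the first steps, which have fewer than [tau]
    predecessors. *)
Definition window (F : nat -> R) (t : nat) : R :=
  \sum_(u < t) (t - u <= tau)%:R * F u.

Lemma window_card t : \sum_(u < t) (t - u <= tau)%:R <= tau%:R :> R.
Proof.
rewrite -natr_sum ler_nat; elim: t => [|t IH]; first by rewrite big_ord0.
rewrite big_ord_recl /=.
have -> : (\sum_(i < t) (t.+1 - bump 0 i <= tau) = \sum_(i < t) (t - i <= tau))%N.
  by apply: eq_bigr => i _; rewrite subSS.
rewrite subn0; case: (leqP t.+1 tau) => ht //.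
  apply: leq_trans ht; rewrite add1n ltnS.
  rewrite -[leqRHS](card_ord t) -sum1_card leq_sum// => i _.
  exact: leq_b1.
Qed.

Lemma window_le_affine (F p : nat -> R) (K N : R) t : 0 <= N ->
  (forall u, (u < t)%N -> F u <= K * p u + N) ->
  window F t <= K * window p t + tau%:R * N.
Proof.
move=> N0 hF.
apply: (@le_trans _ _ (\sum_(u < t) (t - u <= tau)%:R * (K * p u + N))).
  by apply: ler_sum => u _; rewrite ler_wpM2l// hF.
under eq_bigr do rewrite mulrDr mulrCA.
rewrite big_split /= -mulr_sumr -mulr_suml lerD2l ler_wpM2r//.
exact: window_card.
Qed.

(** [j] is an age [t - u], at least 1 in [lyap]; [j.-1] gives the newest term the full weight [lam]
    when [tau] is positive. *)
Definition lyap_weight (lam del : R) (j : nat) : R :=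
  if (j <= tau)%N then lam - (j.-1)%:R * del else 0.

Definition lyap (lam del gamma : R) (A p : nat -> R) (t : nat) : R :=
  A t + gamma * \sum_(u < t) lyap_weight lam del (t - u) * p u.

(** The new term of age 1 is paid by [- gamma * lam * p t]. Ageing lowers a weight by [del], which
    covers the window coefficient [be] and the discount, at most [rho * lam]. Nonnegativity of
    [lam - tau%:R * del] lets the weight drop to 0 after age [tau]. *)
Lemma lyap_contraction (A p : nat -> R) (be lam rho gamma N : R) t :
  let del := be + rho * lam in
  0 <= gamma -> 0 <= be -> 0 <= lam -> 0 <= rho <= 1 ->
  (forall u, (u <= t)%N -> 0 <= p u) ->
  0 <= lam - tau%:R * del ->
  A t.+1 <= (1 - rho) * A t - gamma * lam * p t
     + gamma * be * window p t + N ->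
  lyap lam del gamma A p t.+1 <=
     (1 - rho) * lyap lam del gamma A p t + N.
Proof.
move=> del g0 be0 lam0 /andP[rho0 rho1] p0 hdel hA.
have del0 : 0 <= del by rewrite addr_ge0// mulr_ge0.
have w1 : lyap_weight lam del 1 <= lam.
  by rewrite /lyap_weight; case: ifP => _ //=; rewrite mul0r subr0.
have wS (j : nat) : (0 < j)%N -> lyap_weight lam del j.+1 + be * (j <= tau)%:R
    <= (1 - rho) * lyap_weight lam del j.
  case: j => // j _; rewrite /lyap_weight /=.
  have jd : 0 <= j%:R * del by rewrite mulr_ge0.
  have rjd : 0 <= rho * (j%:R * del) by rewrite mulr_ge0.
  case: (ltnP j tau) => [jt|]; last first.
    by move=> jt; rewrite ltnNge (leq_trans jt)//= !mulr0 addr0.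
  case: ifP => [jt2|jt2].
    rewrite mulr1 -(natr1 j) mulrDl mul1r {2}/del; lra.
  have tj : tau = j.+1.
    by apply/eqP; rewrite eqn_leq jt andbT leqNgt jt2.
  move: hdel; rewrite tj -(natr1 j) mulrDl mul1r add0r mulr1 {2}/del; lra.
rewrite /lyap big_ord_recr /= subSnn.
apply: (le_trans (lerD hA (lexx _))).
rewrite -subr_ge0.
have : 0 <= gamma * ((lam - lyap_weight lam del 1) * p t).
  by rewrite !mulr_ge0 ?subr_ge0// p0.
suff : 0 <= gamma * ((1 - rho) * (\sum_(u < t) lyap_weight lam del (t - u) * p u)
   - \sum_(u < t) lyap_weight lam del (t.+1 - u) * p u - be * window p t).
  rewrite /=; lra.
rewrite mulr_ge0// subr_ge0 /window !mulr_sumr -sumrB; apply: ler_sum => u _.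
have := ler_wpM2r (p0 u (ltnW (ltn_ord u))) (wS (t - u)%N _).
rewrite subn_gt0 ltn_ord => /(_ isT).
rewrite subSn ?(ltnW (ltn_ord u))//; lra.
Qed.

Lemma affine_contraction_le (Phi : nat -> R) (q N : R) (T : nat) :
  0 <= q < 1 -> 0 <= N ->
  (forall t, (t < T)%N -> Phi t.+1 <= q * Phi t + N) ->
  Phi T <= q ^+ T * Phi 0%N + N / (1 - q).
Proof.
move=> /andP[q0 q1] N0 hP; have q1' : 0 < 1 - q by rewrite subr_gt0.
elim: T hP => [|t IH] hP; first by rewrite expr0 mul1r lerDl divr_ge0// ltW.
have {}IH := IH (fun u ut => hP u (ltnW ut)).
rewrite (le_trans (hP t _))// exprS.
have -> : q * q ^+ t * Phi 0%N + N / (1 - q) =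
   q * (q ^+ t * Phi 0%N + N / (1 - q)) + N.
  by field; rewrite gt_eqF.
by rewrite lerD2r ler_wpM2l.
Qed.

(* [17 / 20 = 1 - c] and [23 / 3 = 1 + 1 / c] for [c = 3 / 20], which balances
   the two terms of [A <= (1 + c) * Ah + (1 + 1 / c) * D]. *)
Lemma step_size_budget (s rho a : R) :
  0 <= s <= 1 -> 0 < a -> 5 * (1 + 2 * (tau%:R * s)) * a <= 1 ->
  0 <= rho -> rho <= a * s ^+ 2 ->
  let C := 1 + s * tau%:R in
  let K := s + rho * (23 / 3) * C in
  let al := 2 * a * C in
  let lam := 17 / 20 - al in
  al <= lam - tau%:R * (2 * a * K + rho * lam).
Proof.
move=> /andP[s0 s1] a0 ha rho0 hrho /=.
set T := tau%:R; have T0 : 0 <= T by rewrite /T.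
set z := T * s; rewrite -/z in ha.
have z0 : 0 <= z by rewrite mulr_ge0.
set eta := rho * T.
have eta0 : 0 <= eta by rewrite mulr_ge0.
have heta : eta <= a * z.
  apply: (@le_trans _ _ (a * s ^+ 2 * T)); first by rewrite ler_wpM2r.
  have -> : a * s ^+ 2 * T = a * z * s by rewrite /z; ring.
  by rewrite ler_piMr// mulr_ge0// ltW.
have -> : s * T = z by rewrite mulrC.
rewrite -subr_ge0.
have -> : 17 / 20 - 2 * a * (1 + z) -
    T * (2 * a * (s + rho * (23 / 3) * (1 + z)) +
         rho * (17 / 20 - 2 * a * (1 + z))) - 2 * a * (1 + z) =
  17 / 20 * (1 - eta) - 2 * a * ((2 + 3 * z) + (20 / 3) * eta * (1 + z)).
  by rewrite /eta /z; field.
(* The step size rule says exactly [X <= 1 / 5]. Products of [a] and [z] become polynomials in [X]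
   and [a], and [XX] removes the square of [X]. *)
pose X := a * (1 + 2 * z).
have X5 : X <= 1 / 5 by rewrite /X; lra.
have X0 : 0 <= X by rewrite mulr_ge0 ?(ltW a0)//; lra.
have XX : X * X <= X / 5 by rewrite ler_wpM2l//; lra.
have h1 : eta * (1 + z) <= a * z * (1 + z) by rewrite ler_wpM2r//; lra.
have h2 : a * (eta * (1 + z)) <= a * (a * z * (1 + z)) by rewrite ler_wpM2l// ltW.
have h3 : a * (a * z * (1 + z)) = (X * X - a * a) / 4 by rewrite /X; field.
have h4 : a * z = (X - a) / 2 by rewrite /X; field.
(* [69 / 800] minimises the remaining quadratic in [a]. *)
have := sqr_ge0 (a - 69 / 800); rewrite expr2.
move: h2 heta X5 XX; rewrite h3 h4.
have -> : 2 * a * (2 + 3 * z + 20 / 3 * eta * (1 + z)) =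
  3 * X + a + 40 / 3 * (a * (eta * (1 + z))) by rewrite /X; field.
move: (a * (eta * (1 + z))) => Y; clear; lra.
Qed.

(** In [rho * A], the share of [Ah] costs [23 / 20 * gamma * p] out of the descent [2 * gamma * p].
    Of the remaining [17 / 20], the squared gradient of the current step takes [al]; those in the
    window are charged to [be]. *)
Lemma hogwild_recursion_bound (T : nat) (A G p D Ah : nat -> R)
    (L mu a s sig2 : R) :
  let gamma := a / L in
  let rho := a / (L / mu) in
  let C := 1 + s * tau%:R in
  0 < L -> 0 < mu -> 0 < a -> 0 <= s <= 1 ->
  5 * (1 + 2 * (tau%:R * s)) * a <= 1 -> mu <= L * s ^+ 2 -> 0 <= sig2 ->
  (forall t, (t <= T)%N -> G t <= 2 * L * p t + 2 * sig2) ->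
  (forall t, (t <= T)%N -> 0 <= Ah t) ->
  (forall t, (t <= T)%N -> mu * Ah t <= p t) ->
  (forall t, (t <= T)%N -> D t <= gamma ^+ 2 * C * window G t) ->
  (forall t, (t <= T)%N -> A t <= 23 / 20 * Ah t + 23 / 3 * D t) ->
  (forall t, (t < T)%N -> A t.+1 <= A t - 2 * gamma * p t
     + gamma ^+ 2 * C * G t + gamma ^+ 2 * s * window G t) ->
  Ah T <= 2 * A T + 2 * D T ->
  Ah T <= (1 - rho) ^+ T * (2 * A 0%N) +
    (8 * gamma * (C + tau%:R * (s + gamma * mu * C)) / mu
     + 4 * gamma ^+ 2 * C * tau%:R) * sig2.
Proof.
move=> gamma rho C L0 mu0 a0 s01 ha hmu sig0 hG hAh hp hD hA hrec hT.
have [s0 s1] := andP s01.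
have g0 : 0 < gamma by rewrite divr_gt0.
have rhoE : rho = gamma * mu by rewrite /rho /gamma; field; rewrite !gt_eqF.
have gL : gamma * L = a by rewrite /gamma divfK// gt_eqF.
have rho0 : 0 < rho by rewrite rhoE mulr_gt0.
have hrho : rho <= a * s ^+ 2.
  rewrite rhoE /gamma mulrAC ler_pdivrMr// -mulrA ler_wpM2l ?(ltW a0)//.
  by rewrite mulrC.
have T0 : 0 <= tau%:R :> R by [].
have C0 : 0 <= C by rewrite /C addr_ge0// mulr_ge0.
have sT0 : 0 <= tau%:R * s by rewrite mulr_ge0.
have a5 : 5 * a <= 1.
  have : 0 <= a * (tau%:R * s) by rewrite mulr_ge0 ?(ltW a0).
  by lra.
have s2 : s ^+ 2 <= 1 by rewrite expr_le1.
have rho5 : rho <= 1 / 5.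
  have : a * s ^+ 2 <= a by rewrite ler_piMr ?(ltW a0).
  by lra.
have hbud := step_size_budget _ _ _ s01 a0 ha (ltW rho0) hrho.
rewrite /= -/C in hbud.
(* [K] merges the delay term of the recursion with the share of [D] in [rho * A]. *)
set K := s + rho * (23 / 3) * C in hbud.
set al := 2 * a * C in hbud.
set lam := 17 / 20 - al in hbud.
set be := 2 * a * K in hbud.
have K0 : 0 <= K.
  by rewrite /K addr_ge0// mulr_ge0// mulr_ge0 ?(ltW rho0)//; lra.
have al0 : 0 <= al by rewrite /al !mulr_ge0// ltW.
have be0 : 0 <= be by rewrite /be !mulr_ge0// ltW.
have p0 t : (t <= T)%N -> 0 <= p t.
  by move=> tT; apply: le_trans (hp t tT); rewrite mulr_ge0 ?hAh// ltW.
have lam0 : 0 <= lam.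
  rewrite /lam /al /C; move: ha a5; clear -sT0 a0.
  rewrite (mulrC s).
  have : 0 <= a * (tau%:R * s) by rewrite mulr_ge0 ?(ltW a0).
  by lra.
pose N := 2 * gamma ^+ 2 * sig2 * (C + tau%:R * K).
have gg0 : 0 <= gamma ^+ 2 by rewrite sqr_ge0.
have CK0 : 0 <= C + tau%:R * K by rewrite addr_ge0// mulr_ge0.
have N0 : 0 <= N by rewrite /N mulr_ge0// mulr_ge0// mulr_ge0.
have hW t : (t <= T)%N ->
    window G t <= 2 * L * window p t + tau%:R * (2 * sig2).
  move=> tT; apply: window_le_affine; first by rewrite mulr_ge0.
  by move=> u ut; apply: hG; exact: leq_trans (ltnW ut) tT.
pose del := be + rho * lam.
have step t : (t < T)%N -> lyap lam del gamma A p t.+1 <=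
    (1 - rho) * lyap lam del gamma A p t + N.
  move=> tT; apply: lyap_contraction => //; rewrite ?(ltW g0)//.
  - by rewrite (ltW rho0)/=; lra.
  - by move=> u ut; apply: p0; exact: leq_trans ut (ltnW tT).
  - exact: le_trans hbud.
  apply: (le_trans (hrec t tT)).
  have h1 : rho * A t <= rho * (23 / 20 * Ah t + 23 / 3 * D t).
    by rewrite ler_wpM2l ?(ltW rho0)// hA// ltnW.
  have h2 : rho * Ah t <= gamma * p t.
    by rewrite rhoE -mulrA ler_wpM2l ?(ltW g0)// hp// ltnW.
  have h3 : rho * (23 / 3) * D t <= rho * (23 / 3) * (gamma ^+ 2 * C * window G t).
    rewrite ler_wpM2l ?hD ?(ltnW tT)// mulr_ge0 ?(ltW rho0)//; lra.
  have h4 : gamma ^+ 2 * C * G t <= gamma ^+ 2 * C * (2 * L * p t + 2 * sig2).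
    by apply: ler_wpM2l; [exact: mulr_ge0|exact/hG/ltnW].
  have h5 : gamma ^+ 2 * K * window G t <=
     gamma ^+ 2 * K * (2 * L * window p t + tau%:R * (2 * sig2)).
    by apply: ler_wpM2l; [exact: mulr_ge0|exact/hW/ltnW].
  have e4 : gamma ^+ 2 * C * (2 * L * p t + 2 * sig2) =
     gamma * al * p t + 2 * gamma ^+ 2 * sig2 * C.
    by rewrite /al -gL; ring.
  have e5 : gamma ^+ 2 * K * (2 * L * window p t + tau%:R * (2 * sig2)) =
     gamma * be * window p t + 2 * gamma ^+ 2 * sig2 * (tau%:R * K).
    by rewrite /be -gL; ring.
  have e3 : gamma ^+ 2 * K * window G t = gamma ^+ 2 * s * window G t +
    rho * (23 / 3) * (gamma ^+ 2 * C * window G t).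
    by rewrite /K; ring.
  move: h1 h2 h3 h4 h5; rewrite e4 e5 e3 /N /lam.
  clear; lra.
have q01 : 0 <= 1 - rho < 1 by apply/andP; split; lra.
have := affine_contraction_le _ _ _ T q01 N0 step.
rewrite {2}/lyap big_ord0 mulr0 addr0 subKr => hPhi.
(* By [hbud] every weight of age at most [tau] is at least [al], so the potential also dominates the
   window that bounds [D T]. *)
have hlyap : A T + gamma * al * window p T <= lyap lam del gamma A p T.
  rewrite /lyap lerD2l -mulrA ler_wpM2l ?(ltW g0)// /window mulr_sumr.
  apply: ler_sum => u _; rewrite mulrA ler_wpM2r ?p0 ?(ltnW (ltn_ord u))//.
  rewrite /lyap_weight; case: ifP => hu; last by rewrite mulr0.
  rewrite mulr1; apply: (le_trans hbud); rewrite lerD2l lerN2.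
  rewrite ler_wpM2r//; first by rewrite /del addr_ge0// mulr_ge0// ltW.
  by rewrite ler_nat (leq_trans _ hu)// leq_pred.
have hDT : 2 * D T <= 2 * (gamma * al * window p T) + 4 * gamma ^+ 2 * C * tau%:R * sig2.
  have h1 := hD T (leqnn T).
  have h2 : gamma ^+ 2 * C * window G T <=
      gamma ^+ 2 * C * (2 * L * window p T + tau%:R * (2 * sig2)).
    by apply: ler_wpM2l; [exact: mulr_ge0|exact: hW].
  have e2 : gamma ^+ 2 * C * (2 * L * window p T + tau%:R * (2 * sig2)) =
     gamma * al * window p T + 2 * gamma ^+ 2 * C * tau%:R * sig2.
    by rewrite /al -gL; ring.
  move: h1 h2; rewrite e2; clear; lra.
have hN : 2 * (N / rho) <=
    8 * gamma * (C + tau%:R * (s + gamma * mu * C)) / mu * sig2.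
  have -> : N / rho = 2 * gamma * sig2 / mu * (C + tau%:R * K).
    by rewrite /N rhoE; field; rewrite !gt_eqF.
  have -> : 8 * gamma * (C + tau%:R * (s + gamma * mu * C)) / mu * sig2 =
    2 * (2 * gamma * sig2 / mu * (2 * (C + tau%:R * (s + rho * C)))).
    by rewrite rhoE; field; rewrite gt_eqF.
  rewrite ler_wpM2l// ler_wpM2l//.
    by rewrite divr_ge0 ?(ltW mu0)// mulr_ge0// mulr_ge0// ltW.
  (* [rho * tau <= 1/10] since [a * s * tau <= 1/10] and [rho <= a * s ^ 2]. *)
  have hrt : rho * tau%:R <= 1 / 10.
    have : rho * tau%:R <= a * s ^+ 2 * tau%:R by rewrite ler_wpM2r.
    have -> : a * s ^+ 2 * tau%:R = a * (tau%:R * s) * s by ring.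
    have : a * (tau%:R * s) * s <= a * (tau%:R * s).
      by rewrite ler_piMr// mulr_ge0// ltW.
    by move: ha; clear -a0; lra.
  have hrtC : rho * tau%:R * C <= 1 / 10 * C by rewrite ler_wpM2r.
  (* Replacing [23 / 3] by 2 leaves an excess of at most [17 / 30 * C], absorbed by the spare
     [C]. *)
  rewrite /K; move: hrtC C0 sT0; clear; lra.
move: hT hPhi hlyap hDT hN; rewrite mulrDl; clear; lra.
Qed.

End lyapunov.

(** * Sample points of a HOGWILD process *)

Section hogwild_samples.
Context {R : realType} {dO : measure_display} {Omega : measurableType dO}.
Context {d n : nat}.
Variable P : probability Omega R.
Variables (xhat : nat -> Omega -> 'rV[R]_d) (idx : nat -> Omega -> 'I_n).
Variables (fs : 'I_n -> 'rV[R]_d -> R) (x0 : 'rV[R]_d) (gamma : R).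
Variables (tau : nat) (log : Omega -> nat -> access d).
Hypotheses (d0 : (0 < d)%N) (n0 : (0 < n)%N).
Hypothesis hog : hogwild P xhat idx fs x0 gamma tau log.

Let history t w := [seq (xhat u w, idx u w) | u <- iota 0 t].

Let eq_history t w w' : history t w = history t w' <->
  forall u, (u < t)%N -> xhat u w = xhat u w' /\ idx u w = idx u w'.
Proof.
split=> [/eq_in_map h u ut|h].
  have ui : u \in iota 0 t by rewrite mem_iota.
  by have := h u ui; case=> -> ->.
by apply/eq_in_map => u; rewrite mem_iota => /h[-> ->].
Qed.

(** Strong induction: a history of finite range and finitely many masks leave finitely many values
    for each coordinate. *)
Lemma finite_range_xhat t : finite_set (range (xhat t)).
Proof.
elim/ltn_ind: t => t IH.
have fh : finite_set (range (history t)).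
  apply: (finite_range_map_seq (fun u w => (xhat u w, idx u w))) => u.
  rewrite mem_iota => /IH fu; exact: finite_image11.
have fv v : finite_set (range (fun w => xhat t w 0 v)).
  (* The masks are picked by choice for each [w]; only finiteness of their range enters. *)
  have /choice[c hc] : forall w, exists c : nat -> bool,
      xhat t w 0 v = x0 0 v - gamma * \sum_(u < t) (c u)%:R *
        grad (fs (idx u w)) (xhat u w) 0 v.
    move=> w; have [c [h _]] := read_partial_updates _ _ _ _ _ _ _ d0 (execution hog w) t v.
    by exists c.
  pose z0 : 'rV[R]_d * 'I_n := (0, Ordinal n0).
  apply: (@finite_range_factor _ _ _
    (fun w => ([seq c w u | u <- iota 0 t], history t w)) _
    (fun ch => x0 0 v - gamma * \sum_(u < t) (nth false ch.1 u)%:R *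
        grad (fs (nth z0 ch.2 u).2) (nth z0 ch.2 u).1 0 v)).
    move=> w; rewrite hc /=; congr (_ - _ * _); apply: eq_bigr => u _.
    by rewrite !(nth_map 0%N) ?size_iota// nth_iota// add0n.
  apply: finite_image11 => //.
  apply: (finite_range_map_seq (fun u w => c w u)) => u _.
  exact: finite_finset.
apply: (@finite_range_factor _ _ _ (fun w => [seq xhat t w 0 v | v <- enum 'I_d]) _
  (fun r => \row_v nth 0 r v)).
  move=> w; apply/rowP => v; rewrite mxE (nth_map v) ?size_enum_ord//.
  by rewrite nth_ord_enum.
by apply: (finite_range_map_seq (fun v w => xhat t w 0 v)) => v _.
Qed.

(** The points represent the values of [history T.+1], which includes [idx T], weighted by fiber
    probabilities. The last clause is averaging over a uniform index independent of the past. *)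
Lemma hogwild_sample_mean (T : nat) : exists (ws : seq Omega) (p : Omega -> R),
  [/\ forall w, 0 <= p w,
      sample_mean ws p (fun=> 1) = 1,
      forall X : Omega -> R, (forall w, 0 <= X w) ->
        (forall w w', (forall u, (u <= T)%N ->
           xhat u w = xhat u w' /\ idx u w = idx u w') -> X w = X w') ->
        ('E_P[X] = (sample_mean ws p X)%:E)%E
    & forall t (H : 'I_n -> Omega -> R), (t <= T)%N ->
        (forall i w w', (forall u, (u < t)%N ->
           xhat u w = xhat u w' /\ idx u w = idx u w') ->
           xhat t w = xhat t w' -> H i w = H i w') ->
        sample_mean ws p (fun w => H (idx t w) w) =
        sample_mean ws p (fun w => n%:R^-1 * \sum_i H i w)].
Proof.
have fh t : finite_set (range (history t)).
  apply: (finite_range_map_seq (fun u w => (xhat u w, idx u w))) => u _.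
  by apply: finite_image11; [exact: finite_range_xhat|exact: finite_finset].
have mx u : measurable_fibers (xhat u).
  apply: measurable_fibers_row => v r; rewrite -[X in measurable X]setTI.
  exact: (measurable_xhat hog).
have mi u : measurable_fibers (idx u).
  by move=> i; exact: (measurable_idx hog).
have mh t : measurable_fibers (history t).
  apply: (measurable_fibers_map_seq (fun u w => (xhat u w, idx u w))) => u _.
  exact: measurable_fibers_pair.
have [ws uws hws] := finite_range_samples _ (fh T.+1).
pose p w := fine (P (history T.+1 @^-1` [set history T.+1 w])).
have hE (X : Omega -> R) : (forall w, 0 <= X w) ->
    (forall w w', history T.+1 w = history T.+1 w' -> X w = X w') ->
    ('E_P[X] = (sample_mean ws p X)%:E)%E.
  exact: expectation_sample_mean.
exists ws, p; split.
- by move=> w; rewrite fine_ge0.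
- have := hE (fun=> 1) (fun=> ler01) (fun _ _ _ => erefl).
  by rewrite expectation_cst => -[].
- by move=> X X0 XZ; apply: hE => // w w' /eq_history h; exact: XZ.
move=> t H tT Hh.
apply: (sample_mean_independent P _ _ (history T.+1)
  (fun w => (history t w, xhat t w)) (idx t) H) => //.
- move=> w w' /eq_history h; have [ht it] := h t tT; split=> //.
  suff -> : history t w = history t w' by rewrite ht.
  apply/eq_history => u ut; apply: h.
  by rewrite ltnS ltnW// (leq_trans ut).
- by apply: finite_image11 => //; exact: finite_range_xhat.
- exact: measurable_fibers_pair.
- move=> y i; rewrite (idx_independent hog) ?(idx_uniform hog)//.
  (* [O'] is [Omega] with the sigma-algebra of [past_events t]. The fiber lemmas over it show that
     fixing [history t] and [xhat t] is a past event. *)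
  pose O' := g_sigma_algebraType [set A | (exists u v (B : set R),
      [/\ (u <= t)%N, measurable B & A = (fun w => xhat u w 0 v) @^-1` B])
    \/ (exists u (J : set 'I_n), (u < t)%N /\ A = idx u @^-1` J)].
  have mx' u : (u <= t)%N -> @measurable_fibers _ O' _ (xhat u).
    move=> ut; apply: measurable_fibers_row => v r.
    by apply: sub_sigma_algebra; left; exists u, v, [set r].
  have mi' u : (u < t)%N -> @measurable_fibers _ O' _ (idx u).
    move=> ut j; apply: sub_sigma_algebra; right.
    by exists u, [set j].
  have mh' : @measurable_fibers _ O' _ (history t).
    apply: (@measurable_fibers_map_seq _ O' _ _ (fun u w => (xhat u w, idx u w))) => u.
    rewrite mem_iota add0n => ut.
    exact: (@measurable_fibers_pair _ O' _ _ _ _ (mx' u (ltnW ut)) (mi' u ut)).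
  exact: (@measurable_fibers_pair _ O' _ _ _ _ mh' (mx' t (leqnn t)) y).
- by move=> i w w' [/eq_history h ht]; exact: Hh.
Qed.

End hogwild_samples.

(** * Virtual iterates *)

Section virtual_iterates.
Context {R : realType} {dO : measure_display} {Omega : measurableType dO}.
Context {d n : nat}.
Variable P : probability Omega R.
Variables (xhat : nat -> Omega -> 'rV[R]_d) (idx : nat -> Omega -> 'I_n).
Variables (fs : 'I_n -> 'rV[R]_d -> R) (x0 : 'rV[R]_d) (gamma : R).
Variables (tau : nat) (log : Omega -> nat -> access d).
Hypotheses (d0 : (0 < d)%N) (n0 : (0 < n)%N) (gamma0 : 0 <= gamma).
Hypothesis hog : hogwild P xhat idx fs x0 gamma tau log.
Variables (L mu : R) (xs : 'rV[R]_d).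
Hypotheses (L0 : 0 < L) (mu0 : 0 < mu).
Hypothesis hconv : forall i, convex_function setT (fs i).
Hypothesis hdiff : forall i x, differentiable (fs i) x.
Hypothesis hlip : forall i, lipschitz_grad L (fs i).
Hypothesis hsc : strongly_convex mu (mean_obj fs).
Hypothesis hxs : forall x, mean_obj fs xs <= mean_obj fs x.
Variable s : R.
Hypotheses (s0 : 0 < s) (hs : s ^+ 2 = sparsity fs).

Variables (T : nat) (ws : seq Omega) (p : Omega -> R).
Hypothesis p0 : forall w, 0 <= p w.
Local Notation E := (sample_mean ws p).
Hypothesis E1 : E (fun=> 1) = 1.
Hypothesis Eidx : forall t (H : 'I_n -> Omega -> R), (t <= T)%N ->
  (forall i w w', (forall u, (u < t)%N ->
     xhat u w = xhat u w' /\ idx u w = idx u w') ->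
     xhat t w = xhat t w' -> H i w = H i w') ->
  E (fun w => H (idx t w) w) = E (fun w => n%:R^-1 * \sum_i H i w).

Let g t w := grad (fs (idx t w)) (xhat t w).
Let gs t w := grad (fs (idx t w)) xs.
Let x t w := x0 - gamma *: \sum_(u < t) g u w.
Let G t := E (fun w => dot (g t w) (g t w)).
Let A t := E (fun w => dot (x t w - xs) (x t w - xs)).
Let Ah t := E (fun w => dot (xhat t w - xs) (xhat t w - xs)).
Let D t := E (fun w => dot (xhat t w - x t w) (xhat t w - x t w)).
Let p_ t := E (fun w => dot (g t w - gs t w) (xhat t w - xs)).

Let sqr_normr (k : R) : `|k| ^+ 2 = k ^+ 2.
Proof. by rewrite real_normK ?num_real. Qed.

Let Ecst k : E (fun=> k) = k.
Proof.
rewrite -[RHS]mulr1 -[X in _ = _ * X]E1 -sample_meanZ.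
by apply: eq_sample_mean => w; rewrite mulr1.
Qed.

Lemma mean_sqr_grad_le t : (t <= T)%N ->
  G t <= 2 * L * p_ t + 2 * grad_variance fs xs.
Proof.
move=> tT.
have <- : E (fun w => dot (gs t w) (gs t w)) = grad_variance fs xs.
  rewrite /gs (Eidx t (fun i w => dot (grad (fs i) xs) (grad (fs i) xs)))//.
  rewrite Ecst /grad_variance; congr (_ * _).
  by apply: eq_bigr => i _; rewrite enorm_sqr.
rewrite /p_ -!sample_meanZ -sample_meanD; apply: sample_mean_le => // w.
have := grad_cocoercive L (fs (idx t w)) (xhat t w) xs L0 (hdiff _) (hlip _) (hconv _).
rewrite /= -/(g t w) -/(gs t w) => hc.
(* Nonnegativity of |g - 2 gs|^2 amounts to |g|^2 <= 2 |g - gs|^2 + 2 |gs|^2. *)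
have := dot_ge0 (g t w - gs t w - gs t w).
move: hc; move: (dot _ (xhat t w - xs)) => q.
rewrite !dotE (dotC (gs t w) (g t w)); lra.
Qed.

Lemma mean_strong_monotone t : (t <= T)%N -> mu * Ah t <= p_ t.
Proof.
move=> tT; rewrite /p_ /g /gs (Eidx t (fun i w =>
  dot (grad (fs i) (xhat t w) - grad (fs i) xs) (xhat t w - xs)))//; last first.
  by move=> i w w' _ ->.
rewrite -sample_meanZ; apply: sample_mean_le => // w.
exact: mean_grad_strongly_monotone.
Qed.

(** The single gradients at [xs] need not vanish, so the descent term is [p_ t] plus this mean,
    whose sign comes from minimality after averaging over the index. *)
Lemma mean_minimizer_ge0 t : (t <= T)%N ->
  0 <= E (fun w => dot (gs t w) (xhat t w - xs)).
Proof.
move=> tT; rewrite /gs (Eidx t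
  (fun i w => dot (grad (fs i) xs) (xhat t w - xs)))//; last first.
  by move=> i w w' _ ->.
apply: sample_mean_ge0 => // w; exact: mean_grad_minimizer_ge0.
Qed.

(* Only the coordinates of [g u] in the support of the function sampled at [t]
   matter, and given the past each one lies there with probability at most
   [sparsity fs = s ^ 2]. *)
Lemma mean_abs_dot_grad_le u t : (u < t)%N -> (t <= T)%N ->
  E (fun w => \sum_v `|g u w 0 v| * `|g t w 0 v|) <= s / 2 * (G u + G t).
Proof.
move=> ut tT.
pose M i w : R := \sum_v g u w 0 v ^+ 2 * (v \in grad_support (fs i))%:R.
have hM : E (fun w => M (idx t w) w) <= s ^+ 2 * G u.
  rewrite (Eidx t M)//; last first.
    by move=> i w w' h _; rewrite /M /g; have [-> ->] := h u ut.
  rewrite /G -sample_meanZ; apply: sample_mean_le => // w.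
  rewrite /M exchange_big /= !mulr_sumr; apply: ler_sum => v _.
  rewrite -mulr_sumr mulrCA -expr2 [leRHS]mulrC ler_wpM2l ?sqr_ge0//.
  by rewrite hs; exact: mean_support_le_sparsity.
(* The mean of [M] carries a factor [s ^ 2]; these Young weights turn both coefficients into
   [s / 2]. *)
apply: (@le_trans _ _ (E (fun w => (2 * s)^-1 * M (idx t w) w +
    s / 2 * dot (g t w) (g t w)))).
  apply: sample_mean_le => // w; rewrite /M /dot !mulr_sumr -big_split.
  apply: ler_sum => v _ /=.
  case: (boolP (v \in _)) => hv; last first.
    have -> : g t w 0 v = 0 by exact: grad_support_eq0.
    by rewrite normr0 !mulr0 addr0.
  rewrite mulr1 -expr2 -(sqr_normr (g u w 0 v)) -(sqr_normr (g t w 0 v)).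
  move: (`|g u w 0 v|) (`|g t w 0 v|) => y z.
  have := sqr_ge0 (y - s * z).
  have i0 : 0 <= (2 * s)^-1 by rewrite invr_ge0 mulr_ge0// ltW.
  move=> /(mulr_ge0 i0).
  have -> : (2 * s)^-1 * (y - s * z) ^+ 2 =
    (2 * s)^-1 * y ^+ 2 + s / 2 * z ^+ 2 - y * z by field; rewrite gt_eqF.
  lra.
rewrite sample_meanD !sample_meanZ mulrDr lerD2r -/(G t).
apply: (@le_trans _ _ ((2 * s)^-1 * (s ^+ 2 * G u))).
  by rewrite ler_wpM2l// invr_ge0 mulr_ge0// ltW.
by rewrite le_eqVlt; apply/orP; left; apply/eqP; field; rewrite gt_eqF.
Qed.

Lemma read_errorE t w v :
  `|(xhat t w - x t w) 0 v| <=
  gamma * \sum_(u < t) (t - u <= tau)%:R * `|g u w 0 v|.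
Proof.
have := read_error_le _ _ _ _ _ _ _ d0 (execution hog w) t v gamma0.
by rewrite !mxE summxE.
Qed.

Let C := 1 + s * tau%:R.

Lemma mean_sqr_grad_ge0 t : 0 <= G t.
Proof. by apply: sample_mean_ge0 => // w; exact: dot_ge0. Qed.

(** The read error is dominated coordinatewise by the window of absolute updates; each of the at
    most [tau] pairs costs [s / 2 * (G u + G t)]. *)
Lemma mean_cross_term_le t : (t <= T)%N ->
  E (fun w => dot (g t w) (xhat t w - x t w)) <=
  gamma * (s / 2) * (window tau G t + tau%:R * G t).
Proof.
move=> tT.
apply: (@le_trans _ _ (E (fun w => gamma * \sum_(u < t) (t - u <= tau)%:R *
    \sum_v `|g u w 0 v| * `|g t w 0 v|))).
  apply: sample_mean_le => // w; under eq_bigr do rewrite mulr_sumr.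
  rewrite exchange_big mulr_sumr /dot; apply: ler_sum => v _ /=.
  rewrite (le_trans (ler_norm _))// normrM mulrC.
  rewrite (le_trans (ler_wpM2r _ (read_errorE t w v)))//.
  rewrite -mulrA ler_wpM2l// mulr_suml le_eqVlt; apply/orP; left; apply/eqP.
  by apply: eq_bigr => u _; rewrite mulrA.
rewrite sample_meanZ -mulrA ler_wpM2l// sample_mean_sum.
apply: (@le_trans _ _ (\sum_(u < t) (t - u <= tau)%:R * (s / 2 * (G u + G t)))).
  apply: ler_sum => u _; rewrite sample_meanZ ler_wpM2l//.
  exact: mean_abs_dot_grad_le.
under eq_bigr do rewrite mulrCA mulrDr.
rewrite -mulr_sumr big_split /= ler_wpM2l ?divr_ge0 ?(ltW s0)// lerD2l.
rewrite -mulr_suml ler_wpM2r ?mean_sqr_grad_ge0//.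
exact: window_card.
Qed.

(** Expanding the square gives pairs of updates in the window: the diagonal yields the 1 in [C], and
    sparsity bounds the other pairs by the part [s * tau%:R]. *)
Lemma mean_read_error_le t : (t <= T)%N ->
  D t <= gamma ^+ 2 * C * window tau G t.
Proof.
move=> tT.
pose m u : R := (t - u <= tau)%:R.
have m0 u : 0 <= m u by rewrite /m.
have G0 := mean_sqr_grad_ge0.
apply: (@le_trans _ _ (E (fun w => gamma ^+ 2 * \sum_(u < t) \sum_(r < t)
    m u * m r * \sum_v `|g u w 0 v| * `|g r w 0 v|))).
  apply: sample_mean_le => // w.
  apply: (@le_trans _ _ (\sum_v (gamma * \sum_(u < t) m u * `|g u w 0 v|) ^+ 2)).
    apply: ler_sum => v _; rewrite -expr2 -sqr_normr ler_sqr ?nnegrE//.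
      exact: read_errorE.
    by rewrite mulr_ge0// sumr_ge0// => u _; rewrite mulr_ge0.
  under eq_bigr do rewrite exprMn.
  rewrite -mulr_sumr ler_wpM2l ?sqr_ge0// le_eqVlt; apply/orP; left; apply/eqP.
  under [RHS]eq_bigr do under eq_bigr do rewrite mulr_sumr.
  under [RHS]eq_bigr do rewrite exchange_big /=.
  rewrite [RHS]exchange_big /=; apply: eq_bigr => v _.
  rewrite expr2 mulr_suml; apply: eq_bigr => u _.
  rewrite mulr_sumr; apply: eq_bigr => r _; ring.
rewrite sample_meanZ -mulrA ler_wpM2l ?sqr_ge0// sample_mean_sum.
under eq_bigr do rewrite sample_mean_sum.
(* The off-diagonal bound is charged on the diagonal too, so that the double sum factors. *)
apply: (@le_trans _ _ (\sum_(u < t) \sum_(r < t)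
    (m u * m r * (s / 2 * (G u + G r)) + (r == u)%:R * (m u * G u)))).
  apply: ler_sum => u _; apply: ler_sum => r _; rewrite sample_meanZ.
  have mm0 : 0 <= m u * m r by rewrite mulr_ge0.
  have pair_le (a b : 'I_t) : (a < b)%N ->
      E (fun w => \sum_v `|g a w 0 v| * `|g b w 0 v|) <= s / 2 * (G a + G b).
    by move=> ab; apply: mean_abs_dot_grad_le => //; exact: leq_trans (ltnW (ltn_ord b)) tT.
  case: (ltngtP r u) => ru.
  - rewrite (_ : (r == u) = false) ?mul0r ?addr0 ?ler_wpM2l//; last first.
      by apply/negP => /eqP ru'; move: ru; rewrite ru' ltnn.
    rewrite addrC; apply: le_trans (pair_le _ _ ru).
    rewrite (@eq_sample_mean _ _ _ _ _ _ (fun w => \sum_v `|g r w 0 v| * `|g u w 0 v|))//.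
    by move=> w; apply: eq_bigr => v _; rewrite mulrC.
  - rewrite (_ : (r == u) = false) ?mul0r ?addr0 ?ler_wpM2l ?pair_le//.
    by apply/negP => /eqP ru'; move: ru; rewrite ru' ltnn.
  have {ru}-> : r = u by exact: val_inj.
  rewrite eqxx mul1r.
  have -> : E (fun w => \sum_v `|g u w 0 v| * `|g u w 0 v|) = G u.
    apply: eq_sample_mean => w; apply: eq_bigr => v _.
    by rewrite -!expr2 sqr_normr.
  have mm : m u * m u = m u by rewrite /m; case: (_ <= _)%N; rewrite ?mulr1 ?mulr0.
  rewrite mm lerDr mulr_ge0// mulr_ge0 ?divr_ge0 ?(ltW s0)// addr_ge0//.
under eq_bigr do rewrite big_split /=.
rewrite big_split /= mulrDl mul1r addrC lerD//.
  rewrite le_eqVlt; apply/orP; left; apply/eqP; apply: eq_bigr => u _.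
  by rewrite (bigD1 u)//= eqxx mul1r big1 ?addr0// => r /negbTE ->; rewrite mul0r.
have -> : \sum_(u < t) \sum_(r < t) m u * m r * (s / 2 * (G u + G r)) =
    s * ((\sum_(r < t) m r) * window tau G t).
  have e1 : \sum_(u < t) \sum_(r < t) m u * m r * (s / 2 * G u) =
      s / 2 * ((\sum_(r < t) m r) * window tau G t).
    rewrite mulr_sumr mulr_sumr; apply: eq_bigr => u _.
    rewrite mulr_suml mulr_sumr; apply: eq_bigr => r _; rewrite -/(m u); ring.
  have e2 : \sum_(u < t) \sum_(r < t) m u * m r * (s / 2 * G r) =
      s / 2 * ((\sum_(r < t) m r) * window tau G t).
    rewrite -e1 exchange_big /=; apply: eq_bigr => u _; apply: eq_bigr => r _; ring.
  under eq_bigr do under eq_bigr do rewrite (mulrDr (s / 2)) mulrDr.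
  under eq_bigr do rewrite big_split /=.
  by rewrite big_split /= e1 e2; field.
rewrite -mulrA ler_wpM2l ?(ltW s0)// ler_wpM2r//; last exact: window_card.
by apply: sumr_ge0 => u _; rewrite mulr_ge0.
Qed.

(** A factor 2 on [Ah] would use up the whole descent [2 * gamma * p_ t]; Young's weight [3 / 20]
    leaves [17 / 20 * gamma * p_ t]. *)
Lemma mean_iterate_split t : A t <= 23 / 20 * Ah t + 23 / 3 * D t.
Proof.
rewrite /A /Ah /D -!sample_meanZ -sample_meanD; apply: sample_mean_le => // w.
have -> : x t w - xs = (xhat t w - xs) - (xhat t w - x t w).
  by rewrite opprB [RHS]addrC addrA subrK.
move: (xhat t w - xs) (xhat t w - x t w) => y z.
have := dot_young (3 / 20) y (- z) ltac:(lra).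
rewrite invf_div !dotE (dotC z y); lra.
Qed.

Lemma mean_read_split t : Ah t <= 2 * A t + 2 * D t.
Proof.
rewrite /A /Ah /D -!sample_meanZ -sample_meanD; apply: sample_mean_le => // w.
have -> : xhat t w - xs = (x t w - xs) + (xhat t w - x t w).
  by rewrite [RHS]addrC addrA subrK.
move: (x t w - xs) (xhat t w - x t w) => y z.
have := dot_ge0 (y - z); rewrite !dotE (dotC z y); lra.
Qed.

Lemma mean_iterate_recursion t : (t <= T)%N ->
  A t.+1 <= A t - 2 * gamma * p_ t
     + gamma ^+ 2 * C * G t + gamma ^+ 2 * s * window tau G t.
Proof.
move=> tT.
(* Writing [x t] as [xhat t] minus the read error splits the inner product into [p_ t], the mean at
   the minimizer and the cross term. *)
have -> : A t.+1 = A t + (- (2 * gamma)) * (p_ t + E (fun w => dot (gs t w) (xhat t w - xs)))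
   + (2 * gamma) * E (fun w => dot (g t w) (xhat t w - x t w)) + gamma ^+ 2 * G t.
  rewrite /A /p_ /G -sample_meanD -!sample_meanZ -!sample_meanD.
  apply: eq_sample_mean => w.
  have -> : x t.+1 w - xs = (x t w - xs) - gamma *: g t w.
    by rewrite /x big_ord_recr /= scalerDr opprD addrA [RHS]addrAC.
  have -> : xhat t w - xs = (x t w - xs) + (xhat t w - x t w).
    by rewrite [RHS]addrC addrA subrK.
  move: (x t w - xs) (xhat t w - x t w) => y z.
  rewrite !dotE (dotC y (g t w)); ring.
have h1 := mean_minimizer_ge0 t tT.
have h2 : 0 <= 2 * gamma * E (fun w => dot (gs t w) (xhat t w - xs)).
  by rewrite mulr_ge0// mulr_ge0.
have h3 : 2 * gamma * E (fun w => dot (g t w) (xhat t w - x t w)) <=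
   2 * gamma * (gamma * (s / 2) * (window tau G t + tau%:R * G t)).
  by rewrite ler_wpM2l ?mean_cross_term_le// mulr_ge0.
have e3 : 2 * gamma * (gamma * (s / 2) * (window tau G t + tau%:R * G t)) =
   gamma ^+ 2 * s * window tau G t + gamma ^+ 2 * (C - 1) * G t.
  by rewrite /C; field.
move: h2 h3; rewrite e3; lra.
Qed.

Lemma mean_read_bound (a : R) : 0 < a -> gamma = a / L -> s <= 1 ->
  5 * (1 + 2 * (tau%:R * s)) * a <= 1 ->
  Ah T <= (1 - a / (L / mu)) ^+ T * (2 * dot (x0 - xs) (x0 - xs)) +
    (8 * gamma * (C + tau%:R * (s + gamma * mu * C)) / mu
     + 4 * gamma ^+ 2 * C * tau%:R) * grad_variance fs xs.
Proof.
move=> a0 gE s1 ha.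
have A0 : A 0%N = dot (x0 - xs) (x0 - xs).
  rewrite -[RHS]Ecst; apply: eq_sample_mean => w.
  by rewrite /x big_ord0 scaler0 subr0.
rewrite -A0 gE.
apply: (@hogwild_recursion_bound _ _ _ A G p_ D Ah) => //; rewrite -?gE -/C.
- by rewrite (ltW s0).
- by rewrite hs; exact: strong_convexity_le_sparsity.
- by rewrite mulr_ge0 ?invr_ge0// sumr_ge0// => i _; exact: sqr_ge0.
- exact: mean_sqr_grad_le.
- by move=> t _; apply: sample_mean_ge0 => // w; exact: dot_ge0.
- exact: mean_strong_monotone.
- exact: mean_read_error_le.
- by move=> t _; exact: mean_iterate_split.
- by move=> t tT; apply: mean_iterate_recursion; exact: ltnW.
- exact: mean_read_split.
Qed.

End virtual_iterates.

(** * Convergence *)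

Lemma xi_ge1 (R : realType) (kappa Delta : R) (tau : nat) :
  0 <= kappa -> 1 <= xi kappa Delta tau.
Proof.
by move=> k0; rewrite -[leLHS]sqrtr1 ler_wsqrtr// lerDl mulr_ge0 ?invr_ge0 ?mulr_ge0//
  ?le_min ?invr_ge0 ?sqrtr_ge0.
Qed.

(** As [xi] is at least 1, removing it from the denominator of [a_star] only enlarges the bound. *)
Lemma le_a_star (R : realType) (kappa Delta a : R) (tau : nat) :
  0 <= kappa -> 0 <= a -> a <= a_star kappa Delta tau ->
  5 * (1 + 2 * (tau%:R * Num.sqrt Delta)) * a <= 1.
Proof.
move=> k0 a0 ha; have x1 := xi_ge1 R kappa Delta tau k0.
have B0 : 0 < 1 + 2 * tau%:R * Num.sqrt Delta :> R.
  by rewrite ltr_wpDr// !mulr_ge0// sqrtr_ge0.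
have x0 : 0 < xi kappa Delta tau by exact: lt_le_trans x1.
move: ha; rewrite /a_star -[leRHS]mul1r ler_pdivlMr ?mulr_gt0//; apply: le_trans.
rewrite (mulrA 2) (mulrA a) (mulrC a) ler_peMr// mulr_ge0// mulr_ge0// ltW.
Qed.

Theorem theorem22 (R : realType) (d n : nat) (hd : (0 < d)%N) (hn : (0 < n)%N)
    (fs : 'I_n -> 'rV[R]_d -> R) (L mu : R) (hmu : 0 < mu)
    (hconv : forall i, convex_function setT (fs i))
    (hdiff : forall i x, differentiable (fs i) x)
    (hlip : forall i, lipschitz_grad L (fs i))
    (hsc : strongly_convex mu (mean_obj fs))
    (xs : 'rV[R]_d) (hxs : forall x, mean_obj fs xs <= mean_obj fs x)
    (tau : nat) (a : R) (ha : 0 < a)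
    (ha_star : a <= a_star (L / mu) (sparsity fs) tau)
    (ha_tau : (0 < tau)%N -> a <= (L / mu) / tau%:R)
    (dO : measure_display) (Omega : measurableType dO)
    (P : probability Omega R) (x0 : 'rV[R]_d)
    (xhat : nat -> Omega -> 'rV[R]_d) (idx : nat -> Omega -> 'I_n)
    (log : Omega -> nat -> access d)
    (hog : hogwild P xhat idx fs x0 (a / L) tau log) :
  let kappa := L / mu in
  let gamma := a / L in
  let Delta := sparsity fs in
  let rho := a / kappa in
  let sigma2 := grad_variance fs xs in
  let b := (8 * gamma * (C1 Delta tau + tau%:R * C2 Delta tau mu gamma) / mu
            + 4 * gamma ^+ 2 * C1 Delta tau * tau%:R) * sigma2 in
  forall t : nat,
    ('E_P[(fun w => enorm (xhat t w - xs) ^+ 2)%R]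
     <= ((1 - rho) ^+ t * (2 * enorm (x0 - xs) ^+ 2) + b)%:E)%E.

Proof.
set Delta := sparsity fs; pose s := Num.sqrt Delta.
have D0 : 0 <= Delta by exact: sparsity_ge0.
have hs : s ^+ 2 = Delta by rewrite sqr_sqrtr.
have hmuL := strong_convexity_le_sparsity fs hn L mu hd hdiff hlip hsc.
(* Positivity of [mu] passes to [L * Delta], hence to both factors; [0 < s] then permits dividing by
   [s]. *)
have LD0 : 0 < L * Delta by exact: lt_le_trans hmuL.
have L0 : 0 < L.
  by rewrite ltNge; apply/negP => L0; move: LD0; rewrite ltNge mulr_le0_ge0.
have Dp : 0 < Delta by move: LD0; rewrite pmulr_rgt0.
have s0 : 0 < s by rewrite sqrtr_gt0.
have s1 : s <= 1 by rewrite -sqrtr1 ler_wsqrtr// sparsity_le1.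
have k0 : 0 <= L / mu by rewrite divr_ge0 ?ltW.
have hstep := le_a_star R _ _ _ _ k0 (ltW ha) ha_star.
have g0 : 0 <= a / L by rewrite divr_ge0 ?ltW.
move=> /= t.
have [ws [p [p0 E1 hE Eidx]]] := hogwild_sample_mean _ _ _ _ _ _ _ _ hd hn hog t.
rewrite hE; last 2 first.
- by move=> w; exact: sqr_ge0.
- by move=> w w' /(_ t (leqnn t))[-> _].
rewrite lee_fin enorm_sqr (eq_sample_mean _ _ _ _ (fun w => enorm_sqr (xhat t w - xs))).
exact: (mean_read_bound P xhat idx fs x0 (a / L) tau log hd hn g0 hog L mu xs
  L0 hmu hconv hdiff hlip hsc hxs s s0 hs t ws p p0 E1 Eidx a ha erefl s1 hstep).
Qed.
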